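(* The set of global solutions $A$ (smooth one-forms on $S^3$) to the equation $\mathrm{d}A+2*A=0$ on $S^3$ is equal to the space of left-invariant one-forms on $S^3$.
   Context: $S^3$ is regarded as the Lie group $\mathrm{Sp}(1)$ of unit quaternions with its canonical metric (round, of sectional curvature $1$), $*$ is the Hodge star operator, and $S^3$ is oriented so that an orthonormal left-invariant frame $\{X_1,X_2,X_3\}$ is positively oriented exactly when $[X_1,X_2]=2X_3$, $[X_2,X_3]=2X_1$, $[X_3,X_1]=2X_2$. *)

(* Defs.v *)
From HB Require Import structures.
From mathcomp Require Import all_boot all_order all_algebra.
From mathcomp Require Import all_classical all_reals all_analysis.
From mathcomp Require Import ring lra.

Set Implicit Arguments.
Unset Strict Implicit.
Unset Printing Implicit Defensive.

Import Order.TTheory GRing.Theory Num.Theory.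
Import numFieldNormedType.Exports.

Local Open Scope classical_set_scope.
Local Open Scope ring_scope.

(* The quaternion a + b i + c j + d k is the row vector (a, b, c, d). The norm
   `|x| that the library puts on 'rV[R]_4 is the sup norm; it only serves as a
   source of the topology, and the Euclidean structure is given by dot. *)
Notation quat R := 'rV[R]_4.

Section Quaternions.
Context {R : realType}.
Implicit Types x y : quat R.

Definition mkquat (a b c d : R) : quat R := \row_j [:: a; b; c; d]`_j.

Definition qmul x y : quat R :=
  mkquat (x 0 0 * y 0 0 - x 0 1 * y 0 1 - x 0 2 * y 0 2 - x 0 3 * y 0 3)
         (x 0 0 * y 0 1 + x 0 1 * y 0 0 + x 0 2 * y 0 3 - x 0 3 * y 0 2)
         (x 0 0 * y 0 2 - x 0 1 * y 0 3 + x 0 2 * y 0 0 + x 0 3 * y 0 1)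
         (x 0 0 * y 0 3 + x 0 1 * y 0 2 - x 0 2 * y 0 1 + x 0 3 * y 0 0).

Definition dot x y : R := \sum_j x 0 j * y 0 j.

Lemma dotE x y :
  dot x y = x 0 0 * y 0 0 + x 0 1 * y 0 1 + x 0 2 * y 0 2 + x 0 3 * y 0 3.
Proof.
rewrite /dot !big_ord_recl big_ord0 addr0 !addrA.
by congr (_ * _ + _ * _ + _ * _ + _ * _); congr (_ _ _); apply: val_inj.
Qed.

Lemma mkquatE a b c d :
  (mkquat a b c d 0 0 = a) * (mkquat a b c d 0 1 = b) *
  (mkquat a b c d 0 2 = c) * (mkquat a b c d 0 3 = d).
Proof. by rewrite !mxE. Qed.

Lemma dot_qmul x y z : dot (qmul x y) (qmul x z) = dot x x * dot y z.
Proof. rewrite !dotE !mkquatE; ring. Qed.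

End Quaternions.

Section Sphere.
Context (R : realType).

Record S3 := MkS3 { S3val :> quat R ; S3valP : dot S3val S3val == 1 }.
HB.instance Definition _ := [isSub for S3val].

Lemma S3one_subproof : dot (mkquat 1 0 0 0 : quat R) (mkquat 1 0 0 0) == 1.
Proof. by apply/eqP; rewrite dotE !mkquatE; ring. Qed.
Definition S3one : S3 := MkS3 S3one_subproof.

Lemma S3mul_subproof (p q : S3) : dot (qmul p q) (qmul p q) == 1.
Proof. by rewrite dot_qmul (eqP (S3valP p)) (eqP (S3valP q)) mulr1. Qed.
Definition S3mul (p q : S3) : S3 := MkS3 (S3mul_subproof p q).

(* The retraction x |-> x / |x| of R^4 \ {0} onto S^3 (sent to 1 at x = 0). *)
Definition retr (x : quat R) : S3 :=
  insubd S3one ((Num.sqrt (dot x x))^-1 *: x).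

(* T_p S^3 is the hyperplane orthogonal to p; see tangentE below. *)
Definition tangent (p : S3) : {vspace quat R} :=
  lker (linfun (mulmxr ((p : quat R)^T))).

Notation TS3 p := (subvs_of (tangent p)).

Lemma tangentE (p : S3) v : (v \in tangent p) = (dot p v == 0).
Proof.
rewrite memv_ker lfunE /=; apply/eqP/eqP => [/matrixP/(_ 0 0)|h].
  by rewrite !mxE => <-; apply: eq_bigr => j _; rewrite mxE mulrC.
apply/matrixP => i j; rewrite !ord1 !mxE -[RHS]h.
by apply: eq_bigr => k _; rewrite mxE mulrC.
Qed.

Fixpoint Ck_on (k : nat) (U : set (quat R)) (f : quat R -> R) : Prop :=
  if k is k'.+1 then
    (forall x, U x -> differentiable f x) /\
    (forall v, Ck_on k' U (fun x => 'D_v f x))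
  else forall x, U x -> {for x, continuous f}.

Definition smooth_on (U : set (quat R)) (f : quat R -> R) : Prop :=
  forall k, Ck_on k U f.

Definition smooth (f : S3 -> R) : Prop :=
  forall p : S3, exists (U : set (quat R)) (F : quat R -> R),
    [/\ open U, U p, smooth_on U F & forall q : S3, U q -> F q = f q].

Definition vector_field := forall p : S3, TS3 p.

Definition smooth_vf (X : vector_field) : Prop :=
  forall j, smooth (fun p => vsval (X p) 0 j).

Definition one_form := forall p : S3, 'Hom(TS3 p, R^o).

Definition smooth_form (A : one_form) : Prop :=
  forall X, smooth_vf X -> smooth (fun p => A p (X p)).

(* The derivative of a function on S^3 along v in T_p S^3, computed on the
   extension of the function to R^4 \ {0} by f (x / |x|). *)
Definition deriv (W : normedModType R) (f : S3 -> W) (p : S3) (v : TS3 p) : W :=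
  'D_(vsval v) (f \o retr) (p : quat R).

(* The Lie bracket of vector fields on a submanifold of R^4 is D_X Y - D_Y X.
   For smooth X and Y this vector is tangent to S^3, and so vsproj only changes
   its type (lemma bracketE below). *)
Definition bracket (X Y : vector_field) : vector_field := fun p =>
  vsproj (tangent p) (deriv (fun q => vsval (Y q)) (X p)
                      - deriv (fun q => vsval (X q)) (Y p)).

(* 2-forms are evaluated on pairs of vector fields:
   dA(X, Y) = X(A(Y)) - Y(A(X)) - A([X, Y]). *)
Definition ext_deriv (A : one_form) (X Y : vector_field) (p : S3) : R :=
  deriv (fun q => A q (Y q) : R^o) (X p)
  - deriv (fun q => A q (X q) : R^o) (Y p)
  - A p (bracket X Y p).

(* Left translation L_g p = g p and its differential v |-> g v. *)
Lemma dleft_subproof (g p : S3) (v : TS3 p) :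
  qmul g (vsval v) \in tangent (S3mul g p).
Proof.
rewrite tangentE /= dot_qmul (eqP (S3valP g)) mul1r -tangentE; exact: subvsP.
Qed.
Definition dleft (g p : S3) (v : TS3 p) : TS3 (S3mul g p) :=
  Subvs (dleft_subproof g v).

Definition left_invariant (A : one_form) : Prop :=
  forall (g p : S3) (v : TS3 p), A (S3mul g p) (dleft g v) = A p v.

Definition left_invariant_vf (X : vector_field) : Prop :=
  forall g p : S3, X (S3mul g p) = dleft g (X p).

(* The orthonormal left-invariant frame p i, p j, p k. It fixes the orientation;
   lemma positive_frameP below expresses this orientation through brackets. *)
Definition unit_im (a : 'I_3) : quat R := delta_mx 0 (lift 0 a).

Lemma frame_subproof (a : 'I_3) (p : S3) : qmul p (unit_im a) \in tangent p.
Proof.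
rewrite tangentE; apply/eqP.
case: a => -[|[|[|//]]] h; rewrite dotE !mkquatE /unit_im !mxE /=; ring.
Qed.
Definition frame (a : 'I_3) : vector_field := fun p =>
  Subvs (frame_subproof a p).

(* The Riemannian volume form of the oriented round sphere: the determinant
   of the coordinates in a positively oriented orthonormal basis. *)
Definition vol (p : S3) (u v w : TS3 p) : R :=
  \det (\matrix_(a < 3, b < 3)
          dot (vsval ([:: u; v; w]`_a)) (vsval (frame b p))).

(* *A is the contraction of vol with the vector dual to A, i.e.
   *A = sum_a A(E_a) vol(E_a, _, _) for any orthonormal basis E. *)
Definition hodge (A : one_form) (X Y : vector_field) (p : S3) : R :=
  \sum_(a < 3) A p (frame a p) * vol (frame a p) (X p) (Y p).

End Sphere.

Notation TS3 p := (subvs_of (tangent p)).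
Section SanityChecks.
Context {R : realType}.
Implicit Types (p : S3 R) (X Y : vector_field R).

Let coord_diff (x : quat R) j : differentiable (fun y : quat R => y 0 j : R) x.
Proof. exact: differentiable_coord. Qed.

Let coord_derive (x v : quat R) j :
  is_derive x v (fun y : quat R => y 0 j : R) (v 0 j).
Proof.
apply: DeriveDef; first exact: diff_derivable.
have := @derive_mx R _ _ _ id x v (@derivable_id _ _ _ _).
by rewrite derive_id => {2}->; rewrite mxE.
Qed.

#[local] Existing Instance coord_derive.

Let sqdot (x : quat R) : R := dot x x.

Let sqdotE : sqdot = (fun y => y 0 0) * (fun y => y 0 0) +
 (fun y => y 0 1) * (fun y => y 0 1) +
 (fun y => y 0 2) * (fun y => y 0 2) +
 (fun y => y 0 3) * (fun y => y 0 3).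
Proof. by apply/funext => y; rewrite /sqdot dotE. Qed.

Let sqdot_diff (x : quat R) : differentiable sqdot x.
Proof.
by rewrite sqdotE; do ![apply: differentiableD]; apply: differentiableM.
Qed.

Let sqdot_derive (x v : quat R) : 'd sqdot x v = 2 * dot x v.
Proof.
rewrite -deriveE// sqdotE derive_val dotE /=.
rewrite /GRing.scale /=; ring.
Qed.

Let g (y : R) := (Num.sqrt y)^-1.

Let invnorm_diff (x : quat R) : 0 < dot x x -> differentiable (g \o sqdot) x.
Proof.
move=> x0; apply: differentiable_comp => //.
have dsqrt : differentiable (@Num.sqrt R) (sqdot x).
  by apply/derivable1_diffP; case: (is_derive1_sqrt x0).
apply: (@differentiableV _ _ (@Num.sqrt R)) => //.
by rewrite gt_eqF// sqrtr_gt0.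
Qed.

Let invnorm_derive p (v : TS3 p) :
  is_derive (p : quat R) (vsval v) (g \o sqdot) 0.
Proof.
have p1 : sqdot p = 1 := eqP (S3valP p).
have p0 : 0 < dot (p : quat R) p by rewrite [dot _ _]p1.
apply: DeriveDef; first by apply: diff_derivable; exact: invnorm_diff.
rewrite deriveE; last exact: invnorm_diff.
have dg : differentiable g (sqdot p).
  apply: (@differentiableV _ _ (@Num.sqrt R)).
    by apply/derivable1_diffP; case: (is_derive1_sqrt p0).
  by rewrite gt_eqF// sqrtr_gt0.
rewrite diff_comp//= sqdot_derive.
by have := subvsP v; rewrite tangentE => /eqP ->; rewrite mulr0 linear0.
Qed.

Lemma retrE (x : quat R) : 0 < dot x x ->
  S3val (retr x) = (Num.sqrt (dot x x))^-1 *: x.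
Proof.
move=> x0; rewrite -[S3val _]/(\val (retr x)) /retr insubdK// unfold_in.
have sx : (Num.sqrt (dot x x))^-1 ^+ 2 * dot x x = 1.
  by rewrite exprVn sqr_sqrtr ?ltW// mulVf// gt_eqF.
apply/eqP; rewrite -sx !dotE !mxE; ring.
Qed.

Lemma retr_S3 p : retr p = p.
Proof.
have p1 : dot (p : quat R) p = 1 := eqP (S3valP p).
by apply: val_inj => /=; rewrite retrE p1// sqrtr1 invr1 scale1r.
Qed.

Let near_dot p : \forall x \near (p : quat R), 0 < dot x x.
Proof.
have /differentiable_continuous/cvgr_gt := sqdot_diff p; apply.
by rewrite /sqdot (eqP (S3valP p)).
Qed.

Let retr_coord p (v : TS3 p) j :
  is_derive (p : quat R) (vsval v) (fun x => S3val (retr x) 0 j) (vsval v 0 j).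
Proof.
have H : {near (p : quat R), ((g \o sqdot) * (fun x : quat R => x 0 j))
    =1 (fun x => S3val (retr x) 0 j)}.
  by near=> x; rewrite retrE ?mxE//; near: x; exact: near_dot.
apply: (near_eq_is_derive H).
have D := is_deriveM (invnorm_derive v) (coord_derive (p : quat R) (vsval v) j).
apply: (is_derive_eq D).
by rewrite scaler0 addr0 /= /g /sqdot (eqP (S3valP p)) sqrtr1 invr1 scale1r.
Unshelve. all: by end_near. Qed.

Let deriv_mx (Y : S3 R -> quat R) p (v : TS3 p) (w : quat R) :
  (forall j, is_derive (p : quat R) (vsval v) (fun x => Y (retr x) 0 j) (w 0 j)) ->
  deriv Y v = w.
Proof.
move=> H; rewrite /deriv derive_mx; last first.
  by apply/derivable_mxP => i j; rewrite ord1; case: (H j).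
by apply/rowP => j; rewrite !mxE; case: (H j).
Qed.

Lemma qmulA (x y z : quat R) : qmul x (qmul y z) = qmul (qmul x y) z.
Proof.
apply/rowP => -[[|[|[|[|//]]]] h]; rewrite [LHS]mxE [RHS]mxE /= !mkquatE; ring.
Qed.

Lemma qmulBr (x y z : quat R) : qmul x (y - z) = qmul x y - qmul x z.
Proof.
apply/rowP => -[[|[|[|[|//]]]] h]; rewrite [LHS]mxE [RHS]mxE /= !mxE /=; ring.
Qed.

Lemma qmul1 (x : quat R) : qmul x (S3one R) = x.
Proof.
apply/rowP => -[[|[|[|[|//]]]] h]; rewrite [LHS]mxE /= !mkquatE;
  rewrite !(mulr0, mulr1, oppr0, addr0, add0r, subr0);
  congr (fun_of_matrix x _ _); exact: val_inj.
Qed.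

Lemma left_invariant_frame (a : 'I_3) : left_invariant_vf (@frame R a).
Proof. by move=> g' p; apply: val_inj; rewrite /= -qmulA. Qed.

Lemma dot_frame (a b : 'I_3) p :
  dot (vsval (frame a p)) (vsval (frame b p)) = (a == b)%:R.
Proof.
rewrite /= dot_qmul (eqP (S3valP p)) mul1r dotE !mxE.
by case: a b => -[|[|[|//]]] ? [[|[|[|//]]] ?] /=;
  rewrite !(mulr0, mulr1, addr0, add0r).
Qed.

Let qmul_sum (x y : quat R) j :
  qmul x y 0 j = \sum_(k < 4) x 0 k * qmul (delta_mx 0 k) y 0 j.
Proof.
rewrite -[RHS](_ : dot x (\row_k qmul (delta_mx 0 k) y 0 j) = _); last first.
  by apply: eq_bigr => k _; rewrite mxE.
rewrite dotE !mxE /=.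
by case: j => -[|[|[|[|//]]]] ? /=; ring.
Qed.

Lemma deriv_qmulr (e : quat R) p (v : TS3 p) :
  deriv (fun q : S3 R => qmul q e) v = qmul (vsval v) e.
Proof.
apply: deriv_mx => j.
rewrite (_ : (fun x => _) = \sum_(k < 4)
   ((fun x => S3val (retr x) 0 k) * cst (qmul (delta_mx 0 k) e 0 j))); last first.
  by apply/funext => x; rewrite fct_sumE qmul_sum.
apply: is_derive_eq.
  apply: is_derive_sum => k; apply: is_deriveM; exact: retr_coord.
rewrite qmul_sum; apply: eq_bigr => k _.
by rewrite scaler0 add0r /GRing.scale /= mulrC.
Qed.

Lemma left_invariant_vfE X : left_invariant_vf X ->
  forall p, vsval (X p) = qmul p (vsval (X (S3one R))).
Proof.
move=> XL p; have /(congr1 vsval) /= <- := XL p (S3one R).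
have -> : S3mul p (S3one R) = p by apply: val_inj; exact: qmul1.
by [].
Qed.

Lemma bracket_left_invariant X Y p :
  left_invariant_vf X -> left_invariant_vf Y ->
  let x := vsval (X (S3one R)) in let y := vsval (Y (S3one R)) in
  vsval (bracket X Y p) = qmul p (qmul x y - qmul y x).
Proof.
move=> XL YL x y; rewrite /bracket.
have -> : (fun q => vsval (Y q)) = (fun q : S3 R => qmul q y).
  by apply/funext => q; rewrite (left_invariant_vfE YL).
have -> : (fun q => vsval (X q)) = (fun q : S3 R => qmul q x).
  by apply/funext => q; rewrite (left_invariant_vfE XL).
rewrite !deriv_qmulr (left_invariant_vfE XL p) (left_invariant_vfE YL p).
rewrite -/x -/y -!qmulA -qmulBr vsprojK// tangentE.
rewrite -[X in dot X _]qmul1 dot_qmul (eqP (S3valP p)) mul1r.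
by rewrite dotE /= !mkquatE !mxE /=; apply/eqP; ring.
Qed.

(* The orientation defined by frame, hence by vol, is the one for which an
   orthonormal left-invariant frame X_0, X_1, X_2 is positive exactly when
   [X_0, X_1] = 2 X_2, [X_1, X_2] = 2 X_0 and [X_2, X_0] = 2 X_1. *)
Lemma positive_frameP (X : 'I_3 -> vector_field R) :
  (forall a, left_invariant_vf (X a)) ->
  (forall a b p, dot (vsval (X a p)) (vsval (X b p)) = (a == b)%:R) ->
  (forall p, vol (X 0 p) (X 1 p) (X 2 p) = 1) <->
  (forall p, [/\ bracket (X 0) (X 1) p = 2 *: X 2 p,
                 bracket (X 1) (X 2) p = 2 *: X 0 p &
                 bracket (X 2) (X 0) p = 2 *: X 1 p]).
Proof.
move=> XL XO.
pose u a := vsval (X a (S3one R)).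
pose w (a k : nat) : R := u (inord a) 0 (inord k).
have uE (a : 'I_3) (k : 'I_4) : u a 0 k = w a k by rewrite /w !inord_val.
have w0 (a : 'I_3) : w a 0 = 0.
  have := subvsP (X a (S3one R)); rewrite tangentE dotE /= !mkquatE -/(u a).
  by rewrite mul1r !mul0r !addr0 uE => /eqP.
have wO (a b : 'I_3) :
    w a 1 * w b 1 + w a 2 * w b 2 + w a 3 * w b 3 = (a == b)%:R.
  rewrite -(XO a b (S3one R)) dotE -/(u a) -/(u b) !uE /=.
  by rewrite !w0 mul0r add0r.
have volE p : vol (X 0 p) (X 1 p) (X 2 p) =
    w 0 1 * (w 1 2 * w 2 3 - w 1 3 * w 2 2)
  - w 0 2 * (w 1 1 * w 2 3 - w 1 3 * w 2 1)
  + w 0 3 * (w 1 1 * w 2 2 - w 1 2 * w 2 1).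
  rewrite /vol; set M := \matrix_(_, _) _.
  have ME a b : M a b = w a (lift 0 b).
    rewrite mxE /= (_ : vsval _ = qmul p (u a)); last first.
      by rewrite /u -left_invariant_vfE//; case: a => -[|[|[|//]]] h;
        congr (vsval (X _ p)); exact: val_inj.
    rewrite dot_qmul (eqP (S3valP p)) mul1r dotE !mxE !uE.
    by case: b => -[|[|[|//]]] h /=; rewrite !(mulr0, mulr1, addr0, add0r).
  clearbody M; rewrite (expand_det_row _ 0) !big_ord_recl big_ord0 /cofactor.
  rewrite !(expand_det_row _ 0) !big_ord_recl !big_ord0 /cofactor !det_mx11.
  rewrite !mxE !ME /= /bump /=; ring.
have brE (a b c : 'I_3) : (forall p, bracket (X a) (X b) p = 2 *: X c p) <->
    [/\ w a 2 * w b 3 - w a 3 * w b 2 = w c 1,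
        w a 3 * w b 1 - w a 1 * w b 3 = w c 2 &
        w a 1 * w b 2 - w a 2 * w b 1 = w c 3].
  have E p : bracket (X a) (X b) p = 2 *: X c p <->
     qmul p (qmul (u a) (u b) - qmul (u b) (u a)) = 2 *: qmul p (u c).
    rewrite -bracket_left_invariant// -left_invariant_vfE//.
    by split=> [->|h]; [rewrite linearZ|apply: val_inj; rewrite /= h].
  have cE i : (qmul (u a) (u b) - qmul (u b) (u a)) 0 i = [:: 0;
        2 * (w a 2 * w b 3 - w a 3 * w b 2);
        2 * (w a 3 * w b 1 - w a 1 * w b 3);
        2 * (w a 1 * w b 2 - w a 2 * w b 1)]`_i.
    rewrite !mxE !uE /= !w0.
    by case: i => -[|[|[|[|//]]]] h /=; ring.
  split=> [/(_ (S3one R))/E|[H1 H2 H3] p].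
    have one (z : quat R) : qmul (S3one R) z = z.
      apply/rowP => i; rewrite mxE /= !mkquatE.
      rewrite !(mul0r, mul1r, addr0, add0r, subr0).
      case: i => -[|[|[|[|//]]]] h /=; congr (fun_of_matrix z _ _);
        exact: val_inj.
    rewrite !one => /rowP H.
    have := (H 1, H 2, H 3); rewrite !cE !mxE !uE /= => -[[h1 h2] h3].
    by split; lra.
  apply/E; have -> : qmul (u a) (u b) - qmul (u b) (u a) = 2 *: u c.
    apply/rowP => i; rewrite cE mxE uE H1 H2 H3.
    by case: i => -[|[|[|[|//]]]] h /=; rewrite ?w0 ?mulr0.
  by apply/rowP => i; rewrite !mxE /=;
    case: i => -[|[|[|[|//]]]] h /=; ring.
have := (wO 0 0, wO 1 1, wO 2 2, wO 0 1, wO 0 2, wO 1 2).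
rewrite /= => -[[[[[k00 k11] k22] k01] k02] k12].
have cross (x1 x2 x3 y1 y2 y3 z1 z2 z3 : R) :
    x1 * x1 + x2 * x2 + x3 * x3 = 1 -> y1 * y1 + y2 * y2 + y3 * y3 = 1 ->
    z1 * z1 + z2 * z2 + z3 * z3 = 1 -> x1 * y1 + x2 * y2 + x3 * y3 = 0 ->
    x1 * (y2 * z3 - y3 * z2) - x2 * (y1 * z3 - y3 * z1)
      + x3 * (y1 * z2 - y2 * z1) = 1 ->
    [/\ x2 * y3 - x3 * y2 = z1, x3 * y1 - x1 * y3 = z2 &
        x1 * y2 - x2 * y1 = z3].
  move=> hx hy hz hxy hd.
  have S : (x2 * y3 - x3 * y2 - z1) ^+ 2 + (x3 * y1 - x1 * y3 - z2) ^+ 2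
         + (x1 * y2 - x2 * y1 - z3) ^+ 2 = 0.
    rewrite [LHS](_ : _ =
      (x1 * x1 + x2 * x2 + x3 * x3) * (y1 * y1 + y2 * y2 + y3 * y3)
      - (x1 * y1 + x2 * y2 + x3 * y3) ^+ 2
      + (z1 * z1 + z2 * z2 + z3 * z3)
      - 2 * (x1 * (y2 * z3 - y3 * z2) - x2 * (y1 * z3 - y3 * z1)
             + x3 * (y1 * z2 - y2 * z1))); last by ring.
    by rewrite hx hy hz hxy hd; ring.
  have sq0 (t : R) : t ^+ 2 <= 0 -> t = 0.
    by move=> h; apply/eqP; rewrite -sqrf_eq0 eq_le h sqr_ge0.
  have := (sqr_ge0 (x2 * y3 - x3 * y2 - z1), sqr_ge0 (x3 * y1 - x1 * y3 - z2),
           sqr_ge0 (x1 * y2 - x2 * y1 - z3)) => -[[s1 s2] s3].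
  by split; apply/eqP; rewrite -subr_eq0; apply/eqP; apply: sq0; lra.
split=> [V|H p].
  have {}V := V (S3one R); rewrite volE in V.
  by move=> p; split; move: p; apply/brE => /=; apply: cross => //; lra.
rewrite volE; have [h1 h2 h3] : [/\ w 0 2 * w 1 3 - w 0 3 * w 1 2 = w 2 1,
    w 0 3 * w 1 1 - w 0 1 * w 1 3 = w 2 2 &
    w 0 1 * w 1 2 - w 0 2 * w 1 1 = w 2 3].
  by apply/(brE 0 1 2) => q; case: (H q).
by apply: etrans k22; rewrite /= -h1 -h2 -h3; ring.
Qed.

Let rho (x : quat R) : quat R :=
  (\sum_(j < 4) (fun x => ((g \o sqdot) * (fun y : quat R => y 0 j)) x *:
                          (delta_mx 0 j : quat R))) x.

Let rhoE (x : quat R) : 0 < dot x x -> rho x = retr x.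
Proof.
move=> x0; rewrite retrE// /rho fct_sumE [RHS]row_sum_delta.
by apply: eq_bigr => j _; rewrite mxE.
Qed.

Let rho_diff p : differentiable rho (p : quat R).
Proof.
apply: differentiable_sum => j; apply: differentiableZl.
by apply: differentiableM => //; apply: invnorm_diff; rewrite (eqP (S3valP p)).
Qed.

Lemma smooth_derivable (f : S3 R -> R) p (v : quat R) :
  smooth f -> derivable (f \o @retr R : quat R -> R^o) (p : quat R) v.
Proof.
move=> /(_ p)[U [F [Uo Up FU Ff]]].
have rp : rho p = p by rewrite rhoE ?retr_S3// (eqP (S3valP p)).
have [dF _] := FU 1%N.
have H : {near (p : quat R), F \o rho =1 f \o @retr R}.
  near=> x; have x0 : 0 < dot x x by near: x; exact: near_dot.
  rewrite /= rhoE// Ff// -rhoE//; near: x.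
  have /differentiable_continuous := rho_diff p; apply.
  by rewrite /= rp; exact: open_nbhs_nbhs.
apply: (near_eq_derivable H); apply: diff_derivable.
by apply: differentiable_comp => //; rewrite rp; exact: dF.
Unshelve. all: by end_near. Qed.

Let derive_tangent X p (v : TS3 p) : smooth_vf X ->
  dot (deriv (fun q => vsval (X q)) v) p = - dot (vsval (X p)) (vsval v).
Proof.
move=> Xs.
have DX j := @smooth_derivable _ p (vsval v) (Xs j).
pose c j : R := 'D_(vsval v) ((fun q => vsval (X q) 0 j : R^o) \o @retr R) (p : quat R).
have DX' j : is_derive (p : quat R) (vsval v)
    (fun x => vsval (X (retr x)) 0 j) (c j) by apply: DeriveDef; [exact: DX|].
have -> : deriv (fun q => vsval (X q)) v = \row_j c j.
  by apply: deriv_mx => j; rewrite mxE.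
have Z : (\sum_(j < 4) ((fun x => vsval (X (retr x)) 0 j) *
           (fun x => S3val (retr x) 0 j)) : quat R -> R) = cst 0.
  apply/funext => x; rewrite fct_sumE /=.
  have := subvsP (X (retr x)); rewrite tangentE => /eqP h.
  by apply: etrans h; apply: eq_bigr => j _; exact: mulrC.
have : is_derive (p : quat R) (vsval v) (cst 0 : quat R -> R)
   (\sum_(j < 4) (vsval (X p) 0 j * vsval v 0 j + (p : quat R) 0 j * c j)).
  rewrite -Z; apply: is_derive_eq.
    apply: is_derive_sum => j; apply: is_deriveM; exact: retr_coord.
  by apply: eq_bigr => j _; rewrite retr_S3.
case=> _; rewrite derive_cst big_split /= => /esym/eqP.
rewrite addrC addr_eq0 => /eqP <-.
by apply: eq_bigr => j _; rewrite mxE mulrC.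
Qed.

Lemma bracketE X Y p : smooth_vf X -> smooth_vf Y ->
  vsval (bracket X Y p) = deriv (fun q => vsval (Y q)) (X p)
                          - deriv (fun q => vsval (X q)) (Y p).
Proof.
move=> Xs Ys; rewrite /bracket vsprojK// tangentE.
have dC (x y : quat R) : dot x y = dot y x.
  by apply: eq_bigr => j _; rewrite mulrC.
have dB (x y z : quat R) : dot (x - y) z = dot x z - dot y z.
  by rewrite /dot -sumrB; apply: eq_bigr => j _; rewrite !mxE mulrBl.
by rewrite dC dB !derive_tangent// [dot (vsval (Y p)) _]dC subrr.
Qed.

End SanityChecks.

(* Main.v *)
Require Import Defs.
From mathcomp Require Import all_boot all_order all_algebra.
From mathcomp Require Import all_classical all_reals all_analysis.
From mathcomp Require Import ring lra.

(** Write a_i for the component of A on the i-th field E_i of the left-invariant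
    frame. For i, j, k in cyclic order [E_i, E_j] = 2 E_k, so dA (E_i, E_j) is
    E_i a_j - E_j a_i - 2 a_k, while *A (E_i, E_j) = a_k. Hence dA + 2 *A = 0
    amounts to E_i a_j = E_j a_i for all i and j, and the claim is that these
    equations force the a_i to be constant, constant components being exactly
    left invariance (left_invariantP).

    Applying E_k to E_i a_j = E_j a_i, summing cyclically and rewriting the
    result with the commutators yields E_0 a_0 + E_1 a_1 + E_2 a_2 = 0
    (div_eq0). Differentiating this once more shows that every a_j is killed by
    the Laplacian E_0 E_0 + E_1 E_1 + E_2 E_2 (closed_lap_eq0). A harmonic
    function on the compact connected manifold S^3 is constant
    (harmonic_constant): if f is not constant, some open spherical cap free of
    maximum points of f has a maximum point y on its boundary. A small multiple
    of a power of an affine function of the height, strictly subharmonic in the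
    outer shell of the cap, is added to f so that the maximum of the sum lies in
    this shell, where its Laplacian is positive; this contradicts the
    second-derivative test along great circles (lap_max_le0).

    The commutators come from the symmetry of second derivatives in R^4
    (derive_comm): near each point a smooth function on the sphere has a smooth
    extension F, and E_i is then the derivative of F at x in the direction
    x e_i.

    Conversely, a left-invariant form is A_p (v) = sum_a m_a <v, p e_a> with
    constants m_a. In dA (X, Y) the derivatives of the components of X and Y
    cancel against A [X, Y], and what remains is algebraic in X_p and Y_p: it
    is -2 *A by an identity of quaternions (dot_qmul_vol). *)

Set Implicit Arguments.
Unset Strict Implicit.
Unset Printing Implicit Defensive.

Import Order.TTheory GRing.Theory Num.Theory.
Import numFieldNormedType.Exports Defs.

Local Open Scope classical_set_scope.
Local Open Scope ring_scope.

(** * Smooth functions on open sets of R^4 *)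

(** Differentiability is local: near x the two functions have the same
    first-order expansion. Ck_on_eq rests on it, and is needed because the rules
    for 'D_v compute a derivative on U only. *)
Lemma near_eq_differentiable (R : numFieldType) (V W : normedModType R)
    (F G : V -> W) (x : V) :
  {near x, F =1 G} -> differentiable F x -> differentiable G x.
Proof.
move=> FG dF.
have Gx : G x = F x by rewrite (nbhs_singleton FG).
have oG : G \o shift x = cst (G x) + 'd F x +o_ 0 id.
  have /eqaddoP oF := diff_locally dF.
  apply/eqaddoP => e e0; have := oF e e0.
  have : \forall h \near (0 : V), F (h + x) = G (h + x).
    by move: FG; rewrite (near_shift 0 x) subr0.
  by apply: filterS2 => h /= eh; rewrite !fctE /= Gx -eh.
have dE := diff_unique (diff_continuous dF) oG.
by apply/diff_locallyP; rewrite dE; split=> //; exact: diff_continuous.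
Qed.

Section SmoothOn.
Context {R : realType}.
Implicit Types (U V : set (quat R)) (F G : quat R -> R).

Lemma Ck_onW k U F : Ck_on k.+1 U F -> Ck_on k U F.
Proof.
elim: k F => [|k IHk] F /= [dF DF]; last by split=> // v; exact: IHk (DF v).
by move=> x Ux; apply: differentiable_continuous; exact: dF.
Qed.

Lemma Ck_on_sub k U V F : V `<=` U -> Ck_on k U F -> Ck_on k V F.
Proof.
move=> VU; elim: k F => [|k IHk] F /=; first by move=> cF x /VU; exact: cF.
by move=> [dF DF]; split=> [x /VU/dF//|v]; exact: IHk.
Qed.

Lemma Ck_on_eq k U F G : open U -> {in U, F =1 G} -> Ck_on k U F -> Ck_on k U G.
Proof.
move=> oU; have nU F1 G1 (x : quat R) :
    {in U, F1 =1 G1} -> U x -> {near x, F1 =1 G1}.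
  move=> FG Ux; have : \forall y \near x, U y by exact: open_nbhs_nbhs.
  by apply: filterS => y Uy; apply: FG; rewrite inE.
elim: k F G => [|k IHk] F G FG /=.
  move=> cF x Ux; rewrite /prop_for /continuous_at -(nbhs_singleton (nU _ _ _ FG Ux)).
  by apply: cvg_trans (cF x Ux); have := near_eq_cvg (nU _ _ _ FG Ux); apply.
move=> [dF DF]; split=> [x Ux|v].
  by apply: near_eq_differentiable (dF x Ux); exact: nU.
apply: IHk (DF v) => x; rewrite inE => Ux.
by apply: near_eq_derive; exact: nU.
Qed.

Lemma Ck_on_cst k U (a : R) : Ck_on k U (cst a).
Proof.
elim: k a => [|k IHk] a /=; first by move=> x _; exact: cst_continuous.
split=> [x _|v]; first exact: differentiable_cst.
by rewrite (_ : (fun x => _) = cst 0)//; apply/funext => x; rewrite derive_cst.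
Qed.

Lemma is_derive_coord (x v : quat R) (j : 'I_4) :
  is_derive x v (fun y : quat R => y 0 j : R) (v 0 j).
Proof.
apply: DeriveDef; first by apply: diff_derivable; exact: differentiable_coord.
have := @derive_mx R _ _ _ id x v (@derivable_id _ _ _ _).
by rewrite derive_id => {2}->; rewrite mxE.
Qed.

Lemma Ck_on_coord k U (j : 'I_4) : Ck_on k U (fun x => x 0 j).
Proof.
case: k => [|k] /=; first by move=> x _; exact: coord_continuous.
split=> [x _|v]; first exact: differentiable_coord.
rewrite (_ : (fun x => _) = cst (v 0 j)); first exact: Ck_on_cst.
by apply/funext => x; case: (is_derive_coord x v j).
Qed.

Lemma Ck_onD k U F G : open U ->
  Ck_on k U F -> Ck_on k U G -> Ck_on k U (F + G).
Proof.
move=> oU; elim: k F G => [|k IHk] F G /=.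
  by move=> cF cG x Ux; apply: continuousD; [exact: cF|exact: cG].
move=> [dF DF] [dG DG]; split=> [x Ux|v].
  by apply: differentiableD; [exact: dF|exact: dG].
apply: Ck_on_eq (IHk _ _ (DF v) (DG v)) => // x; rewrite inE => Ux.
by rewrite deriveD//; apply: diff_derivable; [exact: dF|exact: dG].
Qed.

Lemma Ck_onM k U F G : open U ->
  Ck_on k U F -> Ck_on k U G -> Ck_on k U (F * G).
Proof.
move=> oU; elim: k F G => [|k IHk] F G.
  by move=> /= cF cG x Ux; apply: continuousM; [exact: cF|exact: cG].
move=> CF CG; have [F' G'] := (Ck_onW CF, Ck_onW CG).
move: CF CG => /= [dF DF] [dG DG]; split=> [x Ux|v].
  by apply: differentiableM; [exact: dF|exact: dG].
apply: Ck_on_eq (Ck_onD oU (IHk _ _ F' (DG v)) (IHk _ _ G' (DF v))) => // x.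
rewrite inE => Ux.
by rewrite deriveM//; apply: diff_derivable; [exact: dF|exact: dG].
Qed.

Lemma Ck_on_sum n k U (F : 'I_n -> quat R -> R) : open U ->
  (forall i, Ck_on k U (F i)) -> Ck_on k U (fun x => \sum_(i < n) F i x).
Proof.
move=> oU; elim: n F => [|n IHn] F cF.
  rewrite (_ : (fun x => _) = cst 0); first exact: Ck_on_cst.
  by apply/funext => x; rewrite big_ord0.
rewrite (_ : (fun x => _) =
    F ord0 + (fun x => \sum_(i < n) F (lift ord0 i) x)); last first.
  by apply/funext => x; rewrite big_ord_recl.
by apply: Ck_onD => //; exact: IHn.
Qed.

Lemma smooth_on_differentiable U F x :
  smooth_on U F -> U x -> differentiable F x.
Proof. by move=> /(_ 1%N)[dF _]; exact: dF. Qed.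

Lemma smooth_on_derive U F v : smooth_on U F -> smooth_on U (fun x => 'D_v F x).
Proof. by move=> sF k; have [_ DF] := sF k.+1; exact: DF. Qed.

End SmoothOn.

(** * Smooth functions on S^3 *)

Section Smooth.
Context {R : realType}.
Implicit Types (f g : S3 R -> R) (p q : S3 R).

Lemma smooth_cst (a : R) : smooth (fun _ : S3 R => a).
Proof.
move=> p; exists setT, (cst a); split=> //; first exact: openT.
by move=> k; exact: Ck_on_cst.
Qed.

Lemma smooth_coord (j : 'I_4) : smooth (fun q : S3 R => (q : quat R) 0 j).
Proof.
move=> p; exists setT, (fun x => x 0 j); split=> //; first exact: openT.
by move=> k; exact: Ck_on_coord.
Qed.

(** Extensions of f and g near p are combined on the intersection of their
    domains. *)
Lemma smooth_op2 (op : R -> R -> R) :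
  (forall k U (F G : quat R -> R), open U -> Ck_on k U F -> Ck_on k U G ->
     Ck_on k U (fun x => op (F x) (G x))) ->
  forall f g, smooth f -> smooth g -> smooth (fun q => op (f q) (g q)).
Proof.
move=> Hop f g sf sg p.
have [U [F [oU Up sF Ff]]] := sf p; have [V [G [oV Vp sG Gg]]] := sg p.
exists (U `&` V), (fun x => op (F x) (G x)); split.
- exact: openI.
- by [].
- move=> k; apply: Hop; first exact: openI.
    by apply: Ck_on_sub (sF k) => x [].
  by apply: Ck_on_sub (sG k) => x [].
- by move=> q [Uq Vq]; rewrite Ff// Gg.
Qed.

Lemma smoothD f g : smooth f -> smooth g -> smooth (fun q => f q + g q).
Proof. by apply: smooth_op2 => k U F G; exact: Ck_onD. Qed.

Lemma smoothM f g : smooth f -> smooth g -> smooth (fun q => f q * g q).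
Proof. by apply: smooth_op2 => k U F G; exact: Ck_onM. Qed.

Lemma smooth_sum n (f : 'I_n -> S3 R -> R) :
  (forall i, smooth (f i)) -> smooth (fun q => \sum_(i < n) f i q).
Proof.
elim: n f => [|n IHn] f sf.
  rewrite (_ : (fun q => _) = fun=> 0); first exact: smooth_cst.
  by apply/funext => q; rewrite big_ord0.
rewrite (_ : (fun q => _) =
    fun q => f ord0 q + \sum_(i < n) f (lift ord0 i) q); last first.
  by apply/funext => q; rewrite big_ord_recl.
by apply: smoothD => //; exact: IHn.
Qed.

End Smooth.

(** * Derivatives along curves *)

Section Curves.
Context {R : realType}.

Lemma is_derive_comp_curve (V W : normedModType R) (c : R -> V) (F : V -> W)
    (t : R) (u : V) :
  is_derive t 1 c u -> differentiable F (c t) ->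
  is_derive t 1 (F \o c) ('D_u F (c t)).
Proof.
move=> [/derivable1_diffP dc <-] dF.
apply: DeriveDef; first by apply/derivable1_diffP; exact: differentiable_comp.
rewrite deriveE; last exact: differentiable_comp.
by rewrite diff_comp//= -(deriveE _ dc) -deriveE.
Qed.

Lemma is_derive_row n (V : normedModType R) (F : V -> 'rV[R]_n) (x v : V)
    (u : 'rV[R]_n) :
  (forall j, is_derive x v (fun y => F y 0 j) (u 0 j)) -> is_derive x v F u.
Proof.
move=> dF; have D : derivable F x v.
  by apply/derivable_mxP => i j; rewrite ord1; case: (dF j).
apply: DeriveDef => //; rewrite derive_mx//.
by apply/rowP => j; rewrite mxE; case: (dF j).
Qed.

(** The directional derivative at x is the derivative at 0 of the function read
    on the line h |-> x + h v, down to the same difference quotients. *)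
Lemma derive_line (V W : normedModType R) (F : V -> W) (x v : V) :
  ('D_v F x = 'D_1 (fun h : R => F (h *: v + x)) 0) *
  (derivable F x v = derivable (fun h : R => F (h *: v + x)) 0 1).
Proof.
have E : (fun h : R => h^-1 *: (F (h *: v + x) - F x)) =
    (fun h : R => h^-1 *: (((fun h => F (h *: v + x)) \o shift 0) (h *: 1) -
                             F (0 *: v + x))).
  by apply/funext => h; rewrite /= addr0 [h *: 1]mulr1 scale0r add0r.
by rewrite /derivable /derive /= E.
Qed.

Lemma is_derive_line (V W : normedModType R) (F : V -> W) (x v : V) (d : W) :
  is_derive x v F d -> is_derive (0 : R) 1 (fun h => F (h *: v + x)) d.
Proof.
move=> [dF <-]; have [dE DE] := derive_line F x v.
by apply: DeriveDef; rewrite -?DE// dE.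
Qed.

Implicit Types (f g : S3 R -> R) (p q : S3 R).

(** The retraction has the identity as its differential on tangent vectors: this
    is deriv_qmulr for the unit quaternion. *)
Lemma is_derive_retr p (v : TS3 p) :
  is_derive (p : quat R) (vsval v) (fun x => S3val (retr x)) (vsval v).
Proof.
apply: DeriveDef.
  apply/derivable_mxP => i j; rewrite ord1.
  exact: (smooth_derivable (smooth_coord j)).
have -> : (fun x => S3val (retr x)) =
    (fun q : S3 R => qmul q (S3one R)) \o @retr R.
  by apply/funext => x; rewrite /= qmul1.
by rewrite -[RHS]qmul1 -deriv_qmulr.
Qed.

(** The curve t |-> retr (p + t v), along which the derivative on the sphere is
    computed, has velocity v at p and stays on the sphere, where F and f agree. *)
Lemma deriv_ext f p (v : TS3 p) (U : set (quat R)) (F : quat R -> R) :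
  open U -> U p -> (forall q, U q -> F q = f q) -> differentiable F (p : quat R) ->
  deriv (f : S3 R -> R^o) v = 'D_(vsval v) F (p : quat R).
Proof.
move=> oU Up Ff dF.
have dr := is_derive_line (is_derive_retr v).
pose c (h : R) : quat R := retr (h *: vsval v + p).
have c0 : c 0 = p by rewrite /c scale0r add0r retr_S3.
have dFc : is_derive (0 : R) 1 (F \o c) ('D_(vsval v) F (p : quat R)).
  by have := @is_derive_comp_curve _ _ c F 0 _ dr; rewrite c0; apply.
have Fc : {near (0 : R), F \o c =1 fun h => f (retr (h *: vsval v + p))}.
  have cc : {for 0, continuous c}.
    by apply/differentiable_continuous/derivable1_diffP; case: dr.
  near=> h; rewrite /= Ff//; near: h; apply: cc; rewrite c0.
  exact: open_nbhs_nbhs.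
have [_ <-] := near_eq_is_derive Fc dFc.
exact: (derive_line _ _ _).1.
Unshelve. all: by end_near. Qed.

Lemma deriv_compat f p (v : TS3 p) : smooth f ->
  is_derive (p : quat R) (vsval v) (f \o @retr R : quat R -> R^o)
    (deriv (f : S3 R -> R^o) v).
Proof. by move=> sf; apply: DeriveDef => //; exact: smooth_derivable. Qed.

(** The chain rule in R^4, applied to a local extension of f. It turns the frame
    derivatives into one-variable derivatives along great circles. *)
Lemma is_derive_S3_curve f (c : R -> S3 R) (t : R) (v : TS3 (c t)) :
  smooth f -> is_derive t 1 (fun s => S3val (c s)) (vsval v) ->
  is_derive t 1 (f \o c) (deriv (f : S3 R -> R^o) v).
Proof.
move=> sf dc; have [U [F [oU Up sF Ff]]] := sf (c t).
have dF := smooth_on_differentiable sF Up.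
rewrite (deriv_ext v oU Up Ff dF).
have cc : {for t, continuous (fun s => S3val (c s))}.
  by apply/differentiable_continuous/derivable1_diffP; case: dc.
apply: near_eq_is_derive (is_derive_comp_curve dc dF).
near=> s; rewrite /= Ff//; near: s; apply: cc.
exact: open_nbhs_nbhs.
Unshelve. all: by end_near. Qed.

End Curves.

(** * Symmetry of second derivatives *)

Section Schwarz.
Context {R : realType}.

Lemma MVT_cc (f df : R -> R) (a b : R) : a < b ->
  (forall x, x \in `[a, b]%R -> is_derive x 1 f (df x)) ->
  exists2 c, c \in `]a, b[%R & f b - f a = df c * (b - a).
Proof.
move=> ab dF; have dF' x : x \in `]a, b[%R -> is_derive x 1 f (df x).
  by move=> xab; apply: dF; exact: subset_itv_oo_cc.
apply: (MVT ab dF').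
by apply: derivable_within_continuous => x /dF[].
Qed.

Context (V : normedModType R).
Implicit Types (x v w : V) (F : V -> R).

Lemma near_square x v w (P : set V) : nbhs x P ->
  exists2 t : R, 0 < t & forall a b, a \in `[0, t]%R -> b \in `[0, t]%R ->
    P (x + a *: v + b *: w).
Proof.
move=> /nbhs_ballP[e /= e0 eP].
have N0 : 0 < `|v| + `|w| + 1 by rewrite ltr_wpDl// addr_ge0.
exists (e / (`|v| + `|w| + 1)); first by rewrite divr_gt0.
move=> a b; rewrite !in_itv /= => /andP[a0 ae] /andP[b0 be].
apply: eP; rewrite -ball_normE /= -addrA opprD addNKr normrN.
rewrite (le_lt_trans (ler_normD _ _))// !normrZ !ger0_norm//.
apply: (@le_lt_trans _ _ (e / (`|v| + `|w| + 1) * (`|v| + `|w|))).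
  by rewrite mulrDr lerD// ler_wpM2r.
by rewrite mulrAC -mulrA gtr_pMr// ltr_pdivrMr// mul1r ltrDl.
Qed.

(** Two applications of the mean value theorem: first to the difference of the
    values of F on two parallel segments directed by v, then to the derivative
    along v on a segment directed by w. *)
Lemma second_difference F x v w (t : R) : 0 < t ->
  (forall a b, a \in `[0, t]%R -> b \in `[0, t]%R ->
    differentiable F (x + a *: v + b *: w) /\
    differentiable (fun y => 'D_v F y) (x + a *: v + b *: w)) ->
  exists a b, [/\ a \in `[0, t]%R, b \in `[0, t]%R &
    F (x + t *: v + t *: w) - F (x + t *: v) - F (x + t *: w) + F x
      = 'D_w (fun y => 'D_v F y) (x + a *: v + b *: w) * t * t].
Proof.
move=> t0 dF.
have line (y u : V) (s : R) : is_derive s 1 (fun s : R => y + s *: u) u.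
  rewrite -[u in X in is_derive _ _ _ X]add0r; apply: is_deriveD.
  apply: DeriveDef; first exact/derivable1_diffP.
  by rewrite deriveE// diff_val scale1r.
have I0 : 0 \in `[0, t]%R by rewrite in_itv /= lexx ltW.
have It : t \in `[0, t]%R by rewrite in_itv /= lexx ltW.
pose g (s : R) := F (x + t *: w + s *: v) - F (x + s *: v).
have [s|a It' Ea] := @MVT_cc g
  (fun s => 'D_v F (x + s *: v + t *: w) - 'D_v F (x + s *: v)) 0 t t0.
  move=> Is; have [d1 _] := dF _ _ Is It; have [d2 _] := dF _ _ Is I0.
  rewrite scale0r addr0 in d2; rewrite [x + _ + _]addrAC in d1 *.
  exact: (is_deriveB (is_derive_comp_curve (line _ v s) d1)
                     (is_derive_comp_curve (line _ v s) d2)).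
have {}It' := subset_itv_oo_cc It'.
have [s|b Ib Eb] := @MVT_cc (fun s => 'D_v F (x + a *: v + s *: w))
  (fun s => 'D_w (fun y => 'D_v F y) (x + a *: v + s *: w)) 0 t t0.
  move=> Is; have [_ d1] := dF _ _ It' Is.
  exact: (is_derive_comp_curve (line _ w s) d1).
exists a, b; split=> //; first exact: subset_itv_oo_cc.
move: Eb Ea; rewrite /g !subr0 !scale0r !addr0 => <- <-.
by rewrite [x + _ + t *: v]addrAC; ring.
Qed.

End Schwarz.

(** The second difference is symmetric in v and w, so that it is t^2 times a value
    of D_w D_v F and also t^2 times a value of D_v D_w F, both taken within O(t)
    of x. Both second derivatives are continuous: let t tend to 0. *)
Lemma derive_comm (R : realType) (U : set (quat R)) (F : quat R -> R) x v w :
  open U -> U x -> smooth_on U F ->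
  'D_w (fun y => 'D_v F y) x = 'D_v (fun y => 'D_w F y) x.
Proof.
move=> oU Ux sF.
have d u y : U y -> differentiable (fun y => 'D_u F y) y.
  by move=> Uy; exact: (smooth_on_differentiable (smooth_on_derive u sF)).
have c u1 u2 (e : R) : 0 < e -> \forall y \near x,
    `|'D_u1 (fun y => 'D_u2 F y) x - 'D_u1 (fun y => 'D_u2 F y) y| < e.
  have := smooth_on_differentiable
    (smooth_on_derive u1 (smooth_on_derive u2 sF)) Ux.
  by move=> /differentiable_continuous/cvgrPdist_lt; apply.
have close (r s u e : R) : `|r - u| < e / 2 -> `|s - u| < e / 2 -> `|r - s| <= e.
  move=> ru su; rewrite -(subrKA u) (splitr e).
  apply: le_trans (ler_normD _ _) _; apply: lerD; first exact: ltW.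
  by rewrite distrC ltW.
apply/eqP; rewrite -subr_eq0 -normr_le0; apply/ler_addgt0Pl => e e0.
rewrite addr0; have e20 : 0 < e / 2 by rewrite divr_gt0.
have nU : \forall y \near x, U y by exact: open_nbhs_nbhs.
have [t t0 tP] := near_square v w (filterI nU (filterI (c w v _ e20) (c v w _ e20))).
have dF a b : a \in `[0, t]%R -> b \in `[0, t]%R -> forall u,
    differentiable F (x + a *: v + b *: w) /\
    differentiable (fun y => 'D_u F y) (x + a *: v + b *: w).
  move=> Ia Ib u; have [Uab _] := tP a b Ia Ib.
  by split; [exact: smooth_on_differentiable sF _|exact: d].
have [a [b [Ia Ib E1]]] := second_difference t0 (fun a b Ia Ib => dF a b Ia Ib v).
have [|a' [b' [Ia' Ib' E2]]] := @second_difference R _ F x w v t t0.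
  by move=> a' b' Ia' Ib'; rewrite [x + _ + _]addrAC; exact: dF.
have swap (r s : R) : x + r *: v + s *: w = x + s *: w + r *: v by exact: addrAC.
have E : 'D_w (fun y => 'D_v F y) (x + a *: v + b *: w) =
    'D_v (fun y => 'D_w F y) (x + a' *: w + b' *: v).
  apply: (mulIf (lt0r_neq0 t0)); apply: (mulIf (lt0r_neq0 t0)).
  apply: (etrans (esym E1)); apply: (etrans _ E2).
  by rewrite swap; congr (_ + _); exact: addrAC.
have [_ [B1 _]] := tP a b Ia Ib; have [_ [_ B2]] := tP b' a' Ib' Ia'.
rewrite swap in B2.
by rewrite E in B1; exact: close B1 B2.
Qed.

(** * The left-invariant frame as three derivations *)

Section Derivations.
Context {R : realType}.
Implicit Types (f g : S3 R -> R) (p q : S3 R).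
Implicit Types (U : set (quat R)) (F : quat R -> R).

Notation dv f v := (deriv (f : S3 R -> R^o) v).

Lemma derivS3_cst (a : R) p (v : TS3 p) : dv (fun _ => a) v = 0.
Proof. by rewrite /Defs.deriv (_ : _ \o _ = cst a)// derive_cst. Qed.

Lemma derivS3D f g p (v : TS3 p) : smooth f -> smooth g ->
  dv (fun q => f q + g q) v = dv f v + dv g v.
Proof.
move=> sf sg.
by have [_ <-] := is_deriveD (deriv_compat v sf) (deriv_compat v sg).
Qed.

Lemma derivS3M f g p (v : TS3 p) : smooth f -> smooth g ->
  dv (fun q => f q * g q) v = f p * dv g v + g p * dv f v.
Proof.
move=> sf sg.
have [_ E] := is_deriveM (deriv_compat v sf) (deriv_compat v sg).
by rewrite /= retr_S3 in E; exact: E.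
Qed.

Lemma derivS3_sum n (f : 'I_n -> S3 R -> R) p (v : TS3 p) :
  (forall i, smooth (f i)) ->
  dv (fun q => \sum_(i < n) f i q) v = \sum_(i < n) dv (f i) v.
Proof.
elim: n f => [|n IHn] f sf.
  rewrite big_ord0 (_ : (fun q => _) = fun=> 0) ?derivS3_cst//.
  by apply/funext => q; rewrite big_ord0.
rewrite (_ : (fun q => _) =
    fun q => f ord0 q + \sum_(i < n) f (lift ord0 i) q); last first.
  by apply/funext => q; rewrite big_ord_recl.
rewrite derivS3D//; last exact: smooth_sum.
by rewrite IHn// big_ord_recl.
Qed.

Lemma derivS3_coord p (v : TS3 p) (j : 'I_4) :
  dv (fun q => (q : quat R) 0 j) v = vsval v 0 j.
Proof.
rewrite (deriv_ext (U := setT) (F := fun x => x 0 j) v) //.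
- by case: (is_derive_coord p (vsval v) j).
- exact: openT.
- exact: differentiable_coord.
Qed.

Definition dframe (a : 'I_3) f : S3 R -> R := fun p => dv f (frame a p).

Lemma derive_linear (F : quat R -> R) (x u v : quat R) (r : R) :
  differentiable F x -> 'D_(u + r *: v) F x = 'D_u F x + r * 'D_v F x.
Proof. by move=> dF; rewrite !deriveE// linearD linearZ. Qed.

Lemma derive_coordE (F : quat R -> R) (x v : quat R) : differentiable F x ->
  'D_v F x = \sum_j v 0 j * 'D_(delta_mx 0 j) F x.
Proof.
move=> dF; rewrite deriveE// {1}(row_sum_delta v) linear_sum.
by apply: eq_bigr => j _; rewrite linearZ -deriveE.
Qed.

Lemma qmul_coordE (x y : quat R) j :
  qmul x y 0 j = \sum_k x 0 k * qmul (delta_mx 0 k) y 0 j.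
Proof.
rewrite -[RHS](_ : dot x (\row_k qmul (delta_mx 0 k) y 0 j) = _); last first.
  by apply: eq_bigr => k _; rewrite mxE.
by rewrite dotE !mxE /=; case: j => -[|[|[|[|//]]]] ? /=; ring.
Qed.

(** The derivative of F at x in the direction x e_a, written in coordinates so
    that its smoothness is that of sums and products. It extends dframe a f when
    F extends f. *)
Definition dext (a : 'I_3) (F : quat R -> R) (x : quat R) : R :=
  \sum_j qmul x (unit_im R a) 0 j * 'D_(delta_mx 0 j) F x.

Lemma smooth_on_dext a U F : open U -> smooth_on U F -> smooth_on U (dext a F).
Proof.
move=> oU sF k; apply: Ck_on_sum => // j.
have cL : Ck_on k U (fun x => qmul x (unit_im R a) 0 j).
  rewrite (_ : (fun x => qmul x _ _ _) =
      fun x => \sum_i x 0 i * qmul (delta_mx 0 i) (unit_im R a) 0 j); last first.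
    by apply/funext => x; rewrite qmul_coordE.
  apply: Ck_on_sum => // i.
  exact: (Ck_onM oU (Ck_on_coord _ _ i) (Ck_on_cst _ _ _)).
exact: (Ck_onM oU cL (smooth_on_derive _ sF k)).
Qed.

Lemma dframe_ext a f U F : open U -> smooth_on U F ->
  (forall q, U q -> F q = f q) -> forall q, U q -> dext a F q = dframe a f q.
Proof.
move=> oU sF Ff q Uq; have dF := smooth_on_differentiable sF Uq.
by rewrite /dframe (deriv_ext _ oU Uq Ff dF) derive_coordE.
Qed.

Lemma smooth_dframe a f : smooth f -> smooth (dframe a f).
Proof.
move=> sf p; have [U [F [oU Up sF Ff]]] := sf p.
exists U, (dext a F); split=> //; first exact: smooth_on_dext.
exact: dframe_ext.
Qed.

End Derivations.

(** * Commutators of the frame and the Laplacian *)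

Section Laplacian.
Context {R : realType}.
Implicit Types (f g : S3 R -> R) (p q : S3 R).
Implicit Types (U : set (quat R)) (F : quat R -> R).

Lemma is_derive_sum_fun n (F : 'I_n -> quat R -> R) (d : 'I_n -> R) x v :
  (forall i, is_derive x v (F i) (d i)) ->
  is_derive x v (fun x => \sum_(i < n) F i x) (\sum_(i < n) d i).
Proof.
move=> dF; rewrite (_ : (fun x => _) = \sum_(i < n) F i).
  exact: is_derive_sum.
by apply/funext => y; rewrite fct_sumE.
Qed.

Lemma is_derive_qmulr (y x v : quat R) j :
  is_derive x v (fun x => qmul x y 0 j) (qmul v y 0 j).
Proof.
rewrite (_ : (fun x => qmul x y 0 j) =
    fun x => \sum_i x 0 i * qmul (delta_mx 0 i) y 0 j); last first.
  by apply/funext => z; rewrite qmul_coordE.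
rewrite [qmul v _ _ _]qmul_coordE; apply: is_derive_sum_fun => i.
apply: is_derive_eq.
  exact: (is_deriveM (is_derive_coord x v i) (is_derive_cst _ _ _)).
by rewrite /= scaler0 add0r [RHS]mulrC.
Qed.

(** Product rule for the derivative of 'D_(x e_b) F in the direction p e_a: the
    first term comes from the variation of the direction x e_b, and the second
    is the part which is symmetric in a and b. *)
Lemma dframe_dframe (a b : 'I_3) f U F p : open U -> U p -> smooth_on U F ->
  (forall q, U q -> F q = f q) ->
  dframe a (dframe b f) p =
    'D_(qmul (qmul p (unit_im R a)) (unit_im R b)) F (p : quat R) +
    'D_(qmul p (unit_im R b)) (fun x => 'D_(qmul p (unit_im R a)) F x)
      (p : quat R).
Proof.
move=> oU Up sF Ff; set u := qmul p (unit_im R a).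
have sG := smooth_on_dext b oU sF.
rewrite /dframe (deriv_ext _ oU Up (dframe_ext b oU sF Ff)); last first.
  exact: smooth_on_differentiable sG Up.
rewrite /= -/u.
have dF j := smooth_on_differentiable (smooth_on_derive (delta_mx 0 j) sF) Up.
have [_ ->] := is_derive_sum_fun (fun j =>
  is_deriveM (is_derive_qmulr (unit_im R b) p u j)
             (derivableP (@diff_derivable _ _ _ _ _ u (dF j)))).
rewrite (derive_coordE _ (smooth_on_differentiable sF Up)).
rewrite (derive_coordE _
  (smooth_on_differentiable (smooth_on_derive u sF) Up)).
rewrite -big_split; apply: eq_bigr => j _ /=.
have E := derive_comm (delta_mx 0 j) u oU Up sF.
by rewrite E [LHS]addrC; congr (_ + _); rewrite [LHS]mulrC.
Qed.

Lemma quatP (x y : quat R) : x 0 0 = y 0 0 -> x 0 1 = y 0 1 ->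
  x 0 2 = y 0 2 -> x 0 3 = y 0 3 -> x = y.
Proof.
move=> h0 h1 h2 h3; apply/rowP => -[[|[|[|[|//]]]] h].
- by have -> : Ordinal h = 0 by exact: val_inj.
- by have -> : Ordinal h = 1 by exact: val_inj.
- by have -> : Ordinal h = 2 by exact: val_inj.
- by have -> : Ordinal h = 3 by exact: val_inj.
Qed.

Definition cyclic (a b c : 'I_3) : bool :=
  (a, b, c) \in [:: (0, 1, 2); (1, 2, 0); (2, 0, 1)].

Lemma cyclic_rot a b c : cyclic a b c -> cyclic b c a.
Proof. by rewrite /cyclic !inE => /or3P[] /eqP[-> -> ->]. Qed.

Lemma cyclic_ex (a : 'I_3) : exists b c, cyclic a b c.
Proof.
case: a => -[|[|[|//]]] h; [exists 1, 2|exists 2, 0|exists 0, 1];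
  by rewrite /cyclic.
Qed.

Lemma sum_cyclic (V : nmodType) a b c (h : 'I_3 -> V) : cyclic a b c ->
  \sum_i h i = h a + h b + h c.
Proof.
rewrite !big_ord_recr big_ord0 /= add0r.
have -> : widen_ord (leqnSn 2) (widen_ord (leqnSn 1) ord_max) = 0.
  exact: val_inj.
have -> : widen_ord (leqnSn 2) ord_max = 1 by exact: val_inj.
have -> : ord_max = 2 :> 'I_3 by exact: val_inj.
rewrite /cyclic !inE => /or3P[] /eqP[-> -> ->] //.
  by rewrite -addrA addrC.
by rewrite addrC addrA.
Qed.

Lemma qmul_unit (x : quat R) :
  (qmul x (unit_im R 0) = mkquat (- x 0 1) (x 0 0) (x 0 3) (- x 0 2)) *
  (qmul x (unit_im R 1) = mkquat (- x 0 2) (- x 0 3) (x 0 0) (x 0 1)) *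
  (qmul x (unit_im R 2) = mkquat (- x 0 3) (x 0 2) (- x 0 1) (x 0 0)).
Proof.
have E (a b c d a' b' c' d' : R) :
    a = a' -> b = b' -> c = c' -> d = d' -> mkquat a b c d = mkquat a' b' c' d'.
  by move=> -> -> -> ->.
have e (a : 'I_3) (j : 'I_4) : unit_im R a 0 j = (j == lift 0 a)%:R.
  by rewrite /unit_im mxE.
by do ![split]; apply: E; rewrite !e /=; ring.
Qed.

Lemma qmul_unit_comm (x : quat R) a b c : cyclic a b c ->
  qmul (qmul x (unit_im R a)) (unit_im R b) =
  qmul (qmul x (unit_im R b)) (unit_im R a) + 2 *: qmul x (unit_im R c).
Proof.
rewrite /cyclic !inE => /or3P[] /eqP[-> -> ->]; rewrite !qmul_unit !mkquatE;
  by apply/rowP => -[[|[|[|[|//]]]] ?]; rewrite !mxE /=; ring.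
Qed.

(** The bracket relations of the frame, as operators on functions: the symmetric
    parts of the second derivatives cancel, and e_a e_b - e_b e_a = 2 e_c. *)
Lemma dframe_comm a b c f p : cyclic a b c -> smooth f ->
  dframe a (dframe b f) p = dframe b (dframe a f) p + 2 * dframe c f p.
Proof.
move=> abc sf; have [U [F [oU Up sF Ff]]] := sf p.
rewrite !(dframe_dframe _ _ oU Up sF Ff) (qmul_unit_comm _ abc).
have dF := smooth_on_differentiable sF Up.
rewrite (derive_comm _ _ oU Up sF).
rewrite {1}/dframe (deriv_ext _ oU Up Ff dF) /= derive_linear//.
exact: addrAC.
Qed.

Definition lap f p : R := \sum_a dframe a (dframe a f) p.

Lemma dframeD a f g : smooth f -> smooth g ->
  dframe a (fun q => f q + g q) = fun q => dframe a f q + dframe a g q.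
Proof. by move=> sf sg; apply/funext => q; rewrite /dframe derivS3D. Qed.

Lemma dframeM a f g : smooth f -> smooth g ->
  dframe a (fun q => f q * g q) = fun q => f q * dframe a g q + g q * dframe a f q.
Proof. by move=> sf sg; apply/funext => q; rewrite /dframe derivS3M. Qed.

Lemma dframe_cst a (r : R) : dframe a (fun _ : S3 R => r) = fun=> 0.
Proof. by apply/funext => q; rewrite /dframe derivS3_cst. Qed.

Lemma sum_cyclic_differences (x y z u v w : R) :
  x = y + 2 * u -> y = z + 2 * v -> z = x + 2 * w -> u + v + w = 0.
Proof. by lra. Qed.

Lemma sum_opposite_shifts (x y z y' z' u : R) :
  y = y' + 2 * u -> z' = z + 2 * u -> x + y + z = 0 -> x + y' + z' = 0.
Proof. by lra. Qed.

Section Harmonic.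
Context (A : 'I_3 -> S3 R -> R) (sA : forall a, smooth (A a)).
Context (dA : forall a b c, cyclic a b c ->
  forall p, dframe a (A b) p = dframe b (A a) p).

Let sd a b : smooth (dframe a (A b)). Proof. exact: smooth_dframe. Qed.

(** The identity d (dA) = 0, in components: three commutators of the frame
    telescope once the closedness relations are inserted. *)
Lemma div_eq0 a b c : cyclic a b c ->
  forall p, dframe a (A a) p + dframe b (A b) p + dframe c (A c) p = 0.
Proof.
move=> abc p; have bca := cyclic_rot abc; have cab := cyclic_rot bca.
have C1 := dframe_comm p bca (sA a); have C2 := dframe_comm p cab (sA b).
have C3 := dframe_comm p abc (sA c).
have e1 : dframe a (A b) = dframe b (A a) by apply/funext; exact: dA abc.
have e2 : dframe b (A c) = dframe c (A b) by apply/funext; exact: dA bca.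
have e3 : dframe c (A a) = dframe a (A c) by apply/funext; exact: dA cab.
rewrite e3 in C1; rewrite e1 in C2; rewrite e2 in C3.
move: C1 C2 C3; exact: sum_cyclic_differences.
Qed.

(** Turn every E_i E_i a_j into E_i E_j a_i and commute: the first-order terms
    cancel and E_j (div a) = 0 remains. *)
Lemma closed_lap_eq0 a p : lap (A a) p = 0.
Proof.
have [b [c abc]] := cyclic_ex a.
have bca := cyclic_rot abc; have cab := cyclic_rot bca.
rewrite /lap (sum_cyclic _ abc).
have e1 : dframe b (A a) = dframe a (A b) by apply/funext => q; rewrite (dA abc).
have e2 : dframe c (A a) = dframe a (A c) by apply/funext; exact: dA cab.
have e3 : dframe b (A c) p = dframe c (A b) p := dA bca p.
rewrite e1 e2.
have C1 := dframe_comm p abc (sA b); have C2 := dframe_comm p cab (sA c).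
have E0 : (fun q => dframe a (A a) q + dframe b (A b) q + dframe c (A c) q) =
    fun=> 0 by apply/funext; exact: div_eq0.
have D0 := congr1 (@^~ p) (dframeD a (smoothD (sd a a) (sd b b)) (sd c c)).
rewrite /= E0 dframe_cst (dframeD a (sd a a) (sd b b)) in D0.
move/esym in D0.
rewrite e3 in C2.
move: C1 C2 D0; exact: sum_opposite_shifts.
Qed.

End Harmonic.
End Laplacian.

(** * The second-derivative test and extrema on S^3 *)

Section Extrema.
Context {R : realType}.
Implicit Types (f g : S3 R -> R) (p q : S3 R).

(** Were d positive, h1 would be positive just to the right of its zero 0, and h
    would increase there. *)
Lemma second_derivative_max (h h1 : R -> R) (d : R) :
  (forall t : R, is_derive t 1 h (h1 t)) -> is_derive (0 : R) 1 h1 d ->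
  (forall t, h t <= h 0) -> d <= 0.
Proof.
move=> dh [dh1 <-] hmax; rewrite leNgt; apply/negP => d0.
have h10 : h1 0 = 0.
  have [_ <-] := dh 0.
  have dh' (t : R) : t \in `](-1), 1[%R -> derivable h t 1 by case: (dh t).
  have I0 : (0 : R) \in `](-1), 1[%R by rewrite in_itv /= ltrN10 ltr01.
  have le11 : -1 <= 1 :> R by rewrite ge0_cp.
  by have [_ ->] := derive1_at_max le11 dh' I0 (fun t _ => hmax t).
have : \forall s \near (0 : R)^', 0 < s^-1 *: (h1 (s *: 1 + 0) - h1 0).
  exact: (cvgr_gt _ dh1 _ d0).
move=> /nbhs_ballP[e /= e0 eP].
have e20 : 0 < e / 2 by rewrite divr_gt0.
have [c] := MVT_cc e20 (fun s _ => dh s).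
rewrite in_itv /= subr0 => /andP[c0 ce] E.
have : 0 < c^-1 *: (h1 (c *: 1 + 0) - h1 0).
  apply: eP; last by rewrite gt_eqF.
  rewrite -ball_normE /= sub0r normrN gtr0_norm// (lt_trans ce)//.
  by rewrite ltr_pdivrMr// ltr_pMr// ltr1n.
rewrite h10 subr0 addr0 [c *: 1]mulr1 => h1c.
have {}h1c : 0 < h1 c by move: h1c; rewrite pmulr_rgt0// invr_gt0.
have := hmax (e / 2); rewrite leNgt => /negP; apply.
by rewrite -subr_gt0 E mulr_gt0.
Qed.

(** The sphere is closed in R^4, and a smooth function on it is locally the
    restriction of a continuous one. *)
Lemma closed_sphere_ge g (r : R) : smooth g ->
  closed [set x : quat R | exists2 q : S3 R, S3val q = x & r <= g q].
Proof.
move=> sg x clx.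
have dC : continuous (fun x : quat R => dot x x).
  have C : Ck_on 0 setT (fun x : quat R => dot x x).
    apply: Ck_on_sum => [|j]; first exact: openT.
    exact: (Ck_onM openT (Ck_on_coord 0 setT j) (Ck_on_coord 0 setT j)).
  by move=> y; exact: C.
have x1 : dot x x = 1.
  apply/eqP/negPn/negP => x1.
  have N1 : nbhs (dot x x) [set r : R | r != 1].
    by apply: open_nbhs_nbhs; split; [exact: open_neq|exact: x1].
  by have /clx := dC x _ N1; move=>[y [[q <- _]]] /=; rewrite (eqP (S3valP q)) eqxx.
pose p := MkS3 (introT eqP x1); exists p => //; rewrite leNgt; apply/negP => gp.
have [U [G [oU Up sG Gg]]] := sg p.
have cG : {for x, continuous G}.
  exact/differentiable_continuous/(smooth_on_differentiable sG Up).
have nU : \forall y \near x, U y by exact: open_nbhs_nbhs.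
have nG : \forall y \near x, G y < r.
  by apply: (cvgr_lt _ cG); rewrite (Gg p).
have [y [[q <- rq] [Uq]]] := clx _ (filterI nU nG).
by rewrite /= Gg// ltNge rq.
Qed.

(** Extreme values on a closed part of the compact sphere. Applied to a constant
    g it concerns the whole sphere, to a height function a spherical cap, and to
    a function with maximum r the set of its maximum points. *)
Lemma S3_max f g (r : R) : smooth f -> smooth g -> (exists q, r <= g q) ->
  exists2 z, r <= g z & forall q, r <= g q -> f q <= f z.
Proof.
move=> sf sg [q0 rq0].
set A := [set x : quat R | exists2 q : S3 R, S3val q = x & r <= g q].
have cA : compact A.
  apply: bounded_closed_compact; last exact: closed_sphere_ge.
  exists 1; split=> // M M1 _ [q <- _] /=.
  rewrite [leLHS]/Num.Def.normr /= mx_normrE (bigmax_le _ (ltW (lt_trans ltr01 M1)))//.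
  move=> [i j] _ /=; rewrite ord1 (le_trans _ (ltW M1))//.
  rewrite -(@expr_le1 _ 2)// real_normK ?num_real// -(eqP (S3valP q)).
  rewrite /dot (bigD1 j)//= expr2 lerDl sumr_ge0// => k _.
  by rewrite -expr2 sqr_ge0.
have cf : {within A, continuous (f \o @retr R)}.
  apply/subspace_continuousP => _ [p <- rp].
  have [U [F [oU Up sF Ff]]] := sf p.
  have cF : F x @[x --> within A (nbhs (p : quat R))] --> F p.
    apply: cvg_within_filter.
    exact/differentiable_continuous/(smooth_on_differentiable sF Up).
  rewrite /from_subspace /= retr_S3 -Ff//; apply: cvg_trans cF; apply: near_eq_cvg.
  have : \forall y \near (p : quat R), U y by exact: open_nbhs_nbhs.
  rewrite near_withinE; apply: filterS => y Uy [q qy rq].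
  by move: Uy; rewrite -qy /= retr_S3 => /Ff.
have A0 : A !=set0 by exists q0, q0.
have [x] := compact_EVT_max A0 cA cf; rewrite inE => -[z <- rz] zmax.
exists z => // q rq; have := zmax q; rewrite /= !retr_S3; apply.
by rewrite inE; exists q.
Qed.

End Extrema.

(** * The strong maximum principle *)

Section MaximumPrinciple.
Context {R : realType}.
Implicit Types (f g : S3 R -> R) (p q : S3 R).

Lemma dframeZ a (r : R) f : smooth f ->
  dframe a (fun q => r * f q) = fun q => r * dframe a f q.
Proof.
move=> sf; rewrite (dframeM a (smooth_cst r) sf) dframe_cst.
by apply/funext => q; rewrite mulr0 addr0.
Qed.

Lemma lap_affine f g (r : R) p : smooth f -> smooth g ->
  lap (fun q => f q + r * g q) p = lap f p + r * lap g p.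
Proof.
move=> sf sg; rewrite /lap mulr_sumr -big_split; apply: eq_bigr => a _ /=.
have srg := smoothM (smooth_cst r) sg.
rewrite (dframeD a sf srg) (dframeZ a r sg).
have [sDf sDg] := (smooth_dframe a sf, smooth_dframe a sg).
have srDg := smoothM (smooth_cst r) sDg.
by rewrite (dframeD a sDf srDg) (dframeZ a r sDg).
Qed.

Lemma qmulNr (x y : quat R) : qmul x (- y) = - qmul x y.
Proof. by rewrite -[- y]sub0r qmulBr -[in qmul x 0](subrr y) qmulBr subrr sub0r. Qed.

Lemma I3P (a : 'I_3) : [\/ a = 0, a = 1 | a = 2].
Proof.
by case: a => -[|[|[|//]]] h; [constructor 1|constructor 2|constructor 3];
  exact: val_inj.
Qed.

Lemma qmulNunit (y : quat R) a :
  qmul (qmul y (- unit_im R a)) (- unit_im R a) = - y.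
Proof.
rewrite !qmulNr; case: (I3P a) => ->; rewrite !qmul_unit;
  by apply: quatP; rewrite !mxE /= ?mxE /=; ring.
Qed.

Lemma smooth_dot (y : quat R) : smooth (fun q : S3 R => dot q y).
Proof.
apply: smooth_sum => j; exact: (smoothM (smooth_coord j) (smooth_cst _)).
Qed.

Lemma dotNr (x y : quat R) : dot x (- y) = - dot x y.
Proof. by rewrite /dot -sumrN; apply: eq_bigr => j _; rewrite mxE mulrN. Qed.

Lemma dot_qmul_unit (x y : quat R) a :
  dot (qmul x (unit_im R a)) y = dot x (qmul y (- unit_im R a)).
Proof.
rewrite qmulNr dotNr !dotE; case: (I3P a) => ->;
  by rewrite !qmul_unit !mkquatE; ring.
Qed.

Lemma dframe_dot a (y : quat R) :
  dframe a (fun q => dot q y) = fun q => dot q (qmul y (- unit_im R a)).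
Proof.
apply/funext => q; rewrite -dot_qmul_unit /dframe.
rewrite (derivS3_sum (f := fun j q => (q : quat R) 0 j * y 0 j)); last first.
  by move=> j; exact: (smoothM (smooth_coord j) (smooth_cst _)).
apply: eq_bigr => j _.
rewrite (derivS3M _ (smooth_coord j) (smooth_cst _)) derivS3_cst derivS3_coord.
by rewrite mulr0 add0r mulrC.
Qed.

Lemma sum_dot_unit p q :
  \sum_a dot p (qmul q (- unit_im R a)) ^+ 2 = 1 - dot p q ^+ 2.
Proof.
rewrite (@sum_cyclic _ 0 1 2)// !qmulNr !dotNr !sqrrN !qmul_unit.
have -> : 1 = dot p p * dot q q by rewrite (eqP (S3valP p)) (eqP (S3valP q)) mulr1.
by rewrite !dotE !mkquatE; ring.
Qed.

Lemma smoothX f n : smooth f -> smooth (fun q => f q ^+ n).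
Proof.
move=> sf; elim: n => [|n IHn]; first exact: smooth_cst.
rewrite (_ : (fun q => f q ^+ n.+1) = fun q => f q * f q ^+ n).
  exact: smoothM.
by apply/funext => q; rewrite exprS.
Qed.

Lemma dframeX a f n : smooth f ->
  dframe a (fun q => f q ^+ n.+1) = fun q => n.+1%:R * f q ^+ n * dframe a f q.
Proof.
move=> sf; elim: n => [|n IHn].
  by apply/funext => q; rewrite expr0 mulr1 mul1r.
rewrite (_ : (fun q => f q ^+ n.+2) = fun q => f q * f q ^+ n.+1); last first.
  by apply/funext => q; rewrite exprS.
rewrite (dframeM a sf (smoothX n.+1 sf)) IHn; apply/funext => q.
by rewrite exprS -[n.+2]addn1 natrD; ring.
Qed.

(** The barrier: a high power of an affine function of the height along y is
    strictly subharmonic where the height stays away from 1 and -1. The shift by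
    2 makes the base positive, so that the power increases with the height. *)
Definition barrier n (y : quat R) q : R := (dot q y + 2) ^+ n.+2.

Lemma smooth_barrier n y : smooth (barrier n y).
Proof. by apply: smoothX; apply: smoothD (smooth_cst 2); exact: smooth_dot. Qed.

Lemma lap_barrier n (p y : S3 R) :
  lap (barrier n y) p = n.+2%:R * (dot p y + 2) ^+ n *
    (n.+1%:R * (1 - dot p y ^+ 2) - 3 * dot p y * (dot p y + 2)).
Proof.
have sD (z : quat R) := smooth_dot z.
have sc := smoothD (sD y) (smooth_cst 2).
have dc a : dframe a (fun q => dot q y + 2) =
    fun q => dot q (qmul y (- unit_im R a)).
  rewrite (dframeD a (sD y) (smooth_cst 2)) dframe_cst dframe_dot.
  by apply/funext => q; rewrite addr0.
have dd a : dframe a (dframe a (barrier n y)) p = n.+2%:R * (dot p y + 2) ^+ n *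
    (n.+1%:R * dot p (qmul y (- unit_im R a)) ^+ 2 - dot p y * (dot p y + 2)).
  rewrite /barrier (dframeX a n.+1 sc) dc.
  have s1 := smoothX n.+1 sc.
  rewrite (dframeM a (smoothM (smooth_cst n.+2%:R) s1) (sD _)).
  rewrite (dframeZ a _ s1) (dframeX a n sc) dc dframe_dot qmulNunit dotNr.
  by rewrite exprS; ring.
rewrite /lap (eq_bigr _ (fun a _ => dd a)) -mulr_sumr big_split /= -mulr_sumr.
rewrite sum_dot_unit sumr_const card_ord -[_ *+ 3]mulr_natl.
by ring.
Qed.

Lemma dot_sqrD (x y : quat R) (r s : R) :
  dot (r *: x + s *: y) (r *: x + s *: y) =
  r ^+ 2 * dot x x + 2 * (r * s) * dot x y + s ^+ 2 * dot y y.
Proof.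
have E j : (r *: x + s *: y) 0 j = r * x 0 j + s * y 0 j by rewrite !mxE.
by rewrite !dotE !E; ring.
Qed.

(** The curve t |-> z (cos t + e_a sin t) stays on the sphere and is the integral
    curve through z of the a-th frame field. *)
Lemma great_circle_S3 a (z : S3 R) (t : R) :
  let c := cos t *: (z : quat R) + sin t *: qmul z (unit_im R a) in dot c c == 1.
Proof.
apply/eqP.
have zz : dot z z = 1 := eqP (S3valP z).
have zu : dot z (qmul z (unit_im R a)) = 0.
  by have := subvsP (frame a z); rewrite tangentE => /eqP.
have uu : dot (qmul z (unit_im R a)) (qmul z (unit_im R a)) = 1.
  by have := dot_frame a a z; rewrite eqxx.
by rewrite dot_sqrD zz zu uu mulr0 addr0 !mulr1 cos2Dsin2.
Qed.

Definition great_circle a (z : S3 R) (t : R) : S3 R :=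
  MkS3 (great_circle_S3 a z t).

Lemma great_circle0 a z : great_circle a z 0 = z.
Proof.
by apply: val_inj; rewrite /= cos0 sin0 scale1r scale0r addr0.
Qed.

Lemma is_derive_great_circle a z (t : R) :
  is_derive t 1 (fun s => S3val (great_circle a z s))
    (vsval (frame a (great_circle a z t))).
Proof.
have -> : vsval (frame a (great_circle a z t)) =
    - sin t *: (z : quat R) + cos t *: qmul z (unit_im R a).
  rewrite /=; case: (I3P a) => ->; rewrite !qmul_unit;
    by apply: quatP; rewrite !mxE /=; ring.
apply: is_derive_row => j /=; move: (qmul z _) => u.
rewrite (_ : (fun y => _) = fun s => cos s * (z : quat R) 0 j + sin s * u 0 j).
  have D := is_deriveD
    (is_deriveM (is_derive_cos t) (is_derive_cst ((z : quat R) 0 j : R) t 1))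
    (is_deriveM (is_derive_sin t) (is_derive_cst (u 0 j : R) t 1)).
  apply: (is_derive_eq D).
  by rewrite !mxE /= !scaler0 !add0r /GRing.scale /=; ring.
by apply/funext => s; rewrite !mxE.
Qed.

(** The restriction of f to an integral curve of the frame field has derivatives
    E_a f and E_a E_a f. *)
Lemma dframe_max_le0 a f z : smooth f -> (forall q, f q <= f z) ->
  dframe a (dframe a f) z <= 0.
Proof.
move=> sf fz; have sDf := smooth_dframe a sf.
have dh t := is_derive_S3_curve sf (is_derive_great_circle a z t).
have dh1 := is_derive_S3_curve sDf (is_derive_great_circle a z 0).
rewrite great_circle0 in dh1.
apply: (second_derivative_max dh dh1) => t.
by rewrite /= great_circle0.
Qed.

Lemma lap_max_le0 f z : smooth f -> (forall q, f q <= f z) -> lap f z <= 0.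
Proof. by move=> sf fz; apply: sumr_le0 => a _; exact: dframe_max_le0. Qed.

Lemma dot_ge0 (x : quat R) : 0 <= dot x x.
Proof. by apply: sumr_ge0 => j _; rewrite -expr2 sqr_ge0. Qed.

Lemma dot_le0 (x : quat R) : dot x x <= 0 -> x = 0.
Proof.
move=> x0; apply/rowP => j; apply/eqP; rewrite mxE -sqrf_eq0 expr2.
have /eqP : dot x x = 0 by apply/eqP; rewrite eq_le x0 dot_ge0.
rewrite psumr_eq0 => [/allP/(_ j)|i _]; last by rewrite -expr2 sqr_ge0.
by apply; rewrite mem_index_enum.
Qed.

Lemma dot_S3DZ (e : R) p q :
  dot ((p : quat R) + e *: (q : quat R)) ((p : quat R) + e *: (q : quat R)) =
  1 + e ^+ 2 + 2 * e * dot p q.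
Proof.
have [p1 q1] := (eqP (S3valP p), eqP (S3valP q)).
rewrite -[X in X + _ *: _]scale1r dot_sqrD p1 q1; ring.
Qed.

Lemma S3_eq p q : dot p q = 1 -> p = q.
Proof.
move=> pq; apply: val_inj; apply: subr0_eq; apply: dot_le0.
by have := dot_S3DZ (-1) p q; rewrite scaleN1r pq => ->; rewrite sqrrN; lra.
Qed.

Lemma S3_opp p q : dot p q <= -1 -> (p : quat R) = - (q : quat R).
Proof.
move=> pq; apply/eqP; rewrite -addr_eq0; apply/eqP; apply: dot_le0.
by have := dot_S3DZ 1 p q; rewrite scale1r => ->; lra.
Qed.

Lemma dot_S3_bounds p q : -1 <= dot p q <= 1.
Proof.
have := dot_ge0 ((p : quat R) + 1 *: (q : quat R)).
have := dot_ge0 ((p : quat R) + (-1) *: (q : quat R)).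
by rewrite !dot_S3DZ sqrrN expr1n => h1 h2; apply/andP; split; lra.
Qed.

Lemma height_gt0 p q : 0 < dot p q + 2.
Proof. by have /andP[h _] := dot_S3_bounds p q; lra. Qed.

Lemma barrier_gt0 n (y : S3 R) p : 0 < barrier n y p.
Proof. exact/exprn_gt0/height_gt0. Qed.

Lemma barrier_le n (y : S3 R) p : barrier n y p <= 3 ^+ n.+2.
Proof.
have /andP[_ h] := dot_S3_bounds p y.
apply: lerXn2r; rewrite ?nnegrE//; first exact/ltW/height_gt0.
by lra.
Qed.

Lemma barrier_lt n (y : S3 R) p q : dot p y < dot q y ->
  barrier n y p < barrier n y q.
Proof.
move=> pq; apply: ltrXn2r => //; last by rewrite ltrD2r.
exact/ltW/height_gt0.
Qed.

(** For l <= <p, y> <= u the gradient term, (n + 1) (1 - <p, y>^2), outweighs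
    the other one, which is at most 9 in absolute value. *)
Lemma lap_barrier_gt0 n (p y : S3 R) (l u : R) :
  l <= dot p y -> dot p y <= u -> -1 < l -> u < 1 ->
  9 < n.+1%:R * ((1 - u) * (1 + l)) -> 0 < lap (barrier n y) p.
Proof.
move=> ls su l1 u1 nlu; have /andP[s1 s2] := dot_S3_bounds p y.
rewrite lap_barrier mulr_gt0//.
  by rewrite mulr_gt0// exprn_gt0// height_gt0.
set s := dot p y in ls su s1 s2 *.
have : (1 - u) * (1 + l) <= 1 - s ^+ 2.
  rewrite (_ : 1 - s ^+ 2 = (1 - s) * (1 + s)); last by ring.
  by apply: ler_pM; lra.
rewrite -(ler_pM2l (ltr0Sn R n)) => /(lt_le_trans nlu); clear -s1 s2.
by move: (n.+1%:R * _) => X X9; nra.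
Qed.

(** The centre x0 serves unless the maximum point nearest to it is its antipode.
    The antipode is then the only maximum point, and x0 e_0, orthogonal to it, is
    another centre. *)
Lemma touching_ball f (M : R) x0 : smooth f -> f x0 < M -> (exists q, M <= f q) ->
  exists x y, [/\ f x < M, M <= f y, -1 < dot y x &
    forall q, M <= f q -> dot q x <= dot y x].
Proof.
move=> sf fx0 Kne.
have [y0 Ky0 y0max] := S3_max (smooth_dot x0) sf Kne.
have [y0x|x0y] := ltP (-1) (dot y0 x0); first by exists x0, y0.
have Kx q : M <= f q -> (q : quat R) = - (x0 : quat R).
  by move=> Kq; apply: S3_opp; exact: le_trans (y0max _ Kq) x0y.
have x1S : dot (qmul x0 (unit_im R 0)) (qmul x0 (unit_im R 0)) == 1.
  by have := dot_frame 0 0 x0; rewrite /= => ->.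
pose x1 := MkS3 x1S.
have x01 : dot (- (x0 : quat R)) x1 = 0.
  by have := subvsP (frame 0 x0); rewrite tangentE !dotE !mxE /= => /eqP; lra.
exists x1, y0; split=> //.
- rewrite ltNge; apply/negP => /Kx x1E.
  by have := x01; rewrite -x1E (eqP (S3valP x1)) => /eqP; rewrite oner_eq0.
- by rewrite (Kx _ Ky0) x01 ltrN10.
- by move=> q /Kx ->; rewrite (Kx _ Ky0).
Qed.

(** Strong maximum principle: f + e b, with b the barrier of the cap, has its
    maximum in the shell c0 <= <q, x> <= c1, where it is strictly
    subharmonic. Below c0 the barrier is smaller than at y; above c1, by
    compactness, f is smaller than its maximum by a fixed amount, which e b does
    not make up for. *)
Lemma harmonic_constant f : smooth f -> (forall p, lap f p = 0) ->
  exists M, forall p, f p = M.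
Proof.
move=> sf hf.
have [|z _ zmax] := S3_max (r := 0) sf (smooth_cst 0); first by exists (S3one R).
have {}zmax q : f q <= f z by exact: zmax.
exists (f z) => p; apply/eqP; rewrite eq_le zmax leNgt; apply/negP => fp.
have [x [y [fx fy xy yx]]] := touching_ball sf fp (ex_intro _ z (lexx _)).
set c0 := dot y x in xy yx.
have c01 : c0 < 1.
  rewrite lt_neqAle; have /andP[_ ->] := dot_S3_bounds y x.
  rewrite andbT; apply/eqP => /S3_eq yxE; move: fx.
  by rewrite -yxE ltNge fy.
pose c1 := (c0 + 1) / 2.
have [c01' c11] : c0 < c1 /\ c1 < 1.
  by rewrite /c1 ltr_pdivlMr// ltr_pdivrMr//; split; clear -c01; lra.
have [|z1 z1c z1max] := S3_max (r := c1) sf (smooth_dot x).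
  by exists x; rewrite (eqP (S3valP x)) ltW.
have fz1 : f z1 < f z.
  by rewrite ltNge; apply/negP => /yx; rewrite leNgt (lt_le_trans c01').
have k0 : 0 < (1 - c1) * (1 + c0).
  by rewrite mulr_gt0 ?subr_gt0// -(opprK 1) addrC subr_gt0.
pose n := Num.truncn (9 / ((1 - c1) * (1 + c0))).
have nk : 9 < n.+1%:R * ((1 - c1) * (1 + c0)).
  by rewrite -ltr_pdivrMr// truncnS_gt.
have B0 : 0 < (3 : R) ^+ n.+2 by exact: exprn_gt0.
(* e * barrier is at most half of the gap f z - f z1. *)
pose e := (f z - f z1) / 2 / 3 ^+ n.+2.
have e0 : 0 < e by rewrite !divr_gt0// subr_gt0.
pose w q := f q + e * barrier n x q.
have sw : smooth w.
  exact: smoothD sf (smoothM (smooth_cst e) (smooth_barrier n x)).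
have [|z2 _ z2max] := S3_max (r := 0) sw (smooth_cst 0); first by exists (S3one R).
have {}z2max q : w q <= w z2 by exact: z2max.
have wy := z2max y.
have [zc0|c0z] := ltP (dot z2 x) c0.
  have : w z2 < w y.
    rewrite /w; apply: ler_ltD; first exact: le_trans (zmax _) fy.
    by rewrite ltr_pM2l//; exact: barrier_lt.
  by rewrite ltNge wy.
have [zc1|c1z] := leP (dot z2 x) c1; last first.
  have : w z2 < w y.
    rewrite /w; apply: (@lt_trans _ _ (f z)); last first.
      by rewrite -[ltLHS]addr0; apply: ler_ltD => //; rewrite mulr_gt0// barrier_gt0.
    apply: (@le_lt_trans _ _ (f z1 + (f z - f z1) / 2)); last first.
      by clear -fz1; lra.
    apply: lerD; first exact/z1max/ltW.
    rewrite -[leRHS](divfK (lt0r_neq0 B0)) -/e ler_pM2l//.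
    exact: barrier_le.
  by rewrite ltNge wy.
have := lap_max_le0 sw z2max; rewrite leNgt => /negP; apply.
rewrite /w (lap_affine _ _ sf (smooth_barrier n x)) hf add0r mulr_gt0//.
exact: lap_barrier_gt0 c0z zc1 xy c11 nk.
Qed.

End MaximumPrinciple.

(** * One-forms in the left-invariant frame *)

Section OneForms.
Context {R : realType}.
Implicit Types (p q : S3 R) (A : one_form R) (X Y : vector_field R).

Definition fcoord a p (v : TS3 p) : R := dot (vsval v) (vsval (frame a p)).

(** The vectors x, x e_0, x e_1, x e_2 are orthogonal, all of square norm
    <x, x>. *)
Lemma quat_decomp (x y : quat R) : dot x x *: y =
  dot x y *: x + \sum_a dot y (qmul x (unit_im R a)) *: qmul x (unit_im R a).
Proof.
rewrite (@sum_cyclic _ 0 1 2)// !qmul_unit !dotE !mkquatE.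
by apply: quatP; rewrite !mxE /=; ring.
Qed.

Lemma frame_decomp p (v : TS3 p) : v = \sum_a fcoord a v *: frame a p.
Proof.
apply: val_inj; rewrite /= raddf_sum /= -[LHS]scale1r -(eqP (S3valP p)).
rewrite quat_decomp; have := subvsP v; rewrite tangentE => /eqP ->.
by rewrite scale0r add0r; apply: eq_bigr.
Qed.

Lemma one_formE A p (v : TS3 p) :
  A p v = \sum_a fcoord a v * A p (frame a p).
Proof.
rewrite {1}(frame_decomp v) linear_sum; apply: eq_bigr => a _.
by rewrite linearZ.
Qed.

Lemma fcoord_frame a b p : fcoord a (frame b p) = (b == a)%:R.
Proof. exact: dot_frame. Qed.

Lemma det3 (M : 'M[R]_3) : \det M =
  M 0 0 * (M 1 1 * M 2 2 - M 1 2 * M 2 1)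
  - M 0 1 * (M 1 0 * M 2 2 - M 1 2 * M 2 0)
  + M 0 2 * (M 1 0 * M 2 1 - M 1 1 * M 2 0).
Proof.
pose w (i j : nat) := M (inord i) (inord j).
have ME i j : M i j = w i j by rewrite /w !inord_val.
rewrite (expand_det_row _ 0) (@sum_cyclic _ 0 1 2)// /cofactor.
rewrite !(expand_det_row _ 0) !big_ord_recl !big_ord0 /cofactor !det_mx11.
by rewrite !mxE !ME /= /bump /=; ring.
Qed.

Lemma vol_frame a b c p (u v : TS3 p) : cyclic a b c ->
  vol (frame a p) u v = fcoord b u * fcoord c v - fcoord c u * fcoord b v.
Proof.
rewrite /vol det3 !mxE /= -!/(fcoord _ _) !dot_frame.
by rewrite /cyclic !inE => /or3P[] /eqP[-> -> ->] /=; ring.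
Qed.

(** The frame is positively oriented and orthonormal, so that its brackets are
    given by positive_frameP. *)
Lemma frame_bracket a b c p : cyclic a b c ->
  bracket (frame a) (frame b) p = 2 *: frame c p.
Proof.
have /(_ p) : forall p, [/\ bracket (frame 0) (frame 1) p = 2 *: frame 2 p,
    bracket (frame 1) (frame 2) p = 2 *: frame 0 p &
    bracket (frame 2) (frame 0) p = 2 *: frame 1 p :> TS3 p].
  apply/(positive_frameP (@left_invariant_frame R)).
    by move=> i j q; exact: dot_frame.
  move=> q; rewrite (@vol_frame 0 1 2)// !fcoord_frame /=; ring.
by move=> [h0 h1 h2]; rewrite /cyclic !inE => /or3P[] /eqP[-> -> ->].
Qed.

Lemma hodge_frame a b c A p : cyclic a b c ->
  hodge A (frame a) (frame b) p = A p (frame c p).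
Proof.
move=> abc; have bca := cyclic_rot abc; have cab := cyclic_rot bca.
rewrite /hodge (sum_cyclic _ abc) (vol_frame _ _ abc) (vol_frame _ _ bca).
rewrite (vol_frame _ _ cab) !fcoord_frame.
by move: abc; rewrite /cyclic !inE => /or3P[] /eqP[-> -> ->] /=; ring.
Qed.

Lemma smooth_qmulr (y : quat R) j : smooth (fun q : S3 R => qmul q y 0 j).
Proof.
rewrite (_ : (fun q => _) =
    fun q : S3 R => \sum_k (q : quat R) 0 k * qmul (delta_mx 0 k) y 0 j).
  by apply: smooth_sum => k; exact: (smoothM (smooth_coord k) (smooth_cst _)).
by apply/funext => q; rewrite qmul_coordE.
Qed.

Lemma smooth_frame a : smooth_vf (@frame R a).
Proof. by move=> j; exact: smooth_qmulr. Qed.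

Lemma ext_deriv_frame a b c A p : cyclic a b c ->
  ext_deriv A (frame a) (frame b) p =
  dframe a (fun q => A q (frame b q)) p - dframe b (fun q => A q (frame a q)) p
  - 2 * A p (frame c p).
Proof. by move=> abc; rewrite /ext_deriv (frame_bracket _ abc) linearZ. Qed.

(** Left translations permute the frame vectors of the same index, hence an
    invariant form has constant components, and the frame spans every tangent
    space. *)
Lemma left_invariantP A :
  left_invariant A <-> exists m : 'I_3 -> R, forall a p, A p (frame a p) = m a.
Proof.
split=> [AL|[m Am] g p v].
  exists (fun a => A (S3one R) (frame a (S3one R))) => a p.
  have := AL p (S3one R) (frame a (S3one R)).
  rewrite -left_invariant_frame.
  by have -> : S3mul p (S3one R) = p by apply: val_inj; exact: qmul1.
rewrite !one_formE; apply: eq_bigr => a _; rewrite !Am; congr (_ * _).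
by rewrite /fcoord /= -qmulA dot_qmul (eqP (S3valP g)) mul1r.
Qed.

Lemma solution_left_invariant A : smooth_form A ->
  (forall X Y, smooth_vf X -> smooth_vf Y ->
     forall p, ext_deriv A X Y p + 2 * hodge A X Y p = 0) ->
  left_invariant A.
Proof.
move=> sA dA; pose f a (q : S3 R) := A q (frame a q).
have sf a : smooth (f a) := sA _ (smooth_frame a).
have df a b c : cyclic a b c -> forall p, dframe a (f b) p = dframe b (f a) p.
  move=> abc p; have := dA _ _ (smooth_frame a) (smooth_frame b) p.
  rewrite (ext_deriv_frame _ _ abc) (hodge_frame _ _ abc) subrK.
  by move/subr0_eq.
have lf a := harmonic_constant (sf a) (closed_lap_eq0 sf df a).
have [m fm] := choice lf.
by apply/left_invariantP; exists m => a p; exact: fm.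
Qed.

Section LeftInvariant.
Context (A : one_form R) (m : 'I_3 -> R).
Context (Am : forall a p, A p (frame a p) = m a).

Let AE p (v : TS3 p) : A p v = \sum_a fcoord a v * m a.
Proof. by rewrite one_formE; under eq_bigr do rewrite Am. Qed.

Lemma smooth_fcoord a X : smooth_vf X -> smooth (fun q => fcoord a (X q)).
Proof.
by move=> sX; apply: smooth_sum => j; exact: (smoothM (sX j) (smooth_frame a j)).
Qed.

Lemma left_invariant_smooth : smooth_form A.
Proof.
move=> X sX; rewrite (_ : (fun p => _) = fun p => \sum_a fcoord a (X p) * m a).
  apply: smooth_sum => a; exact: (smoothM (smooth_fcoord a sX) (smooth_cst _)).
by apply/funext => p; exact: AE.
Qed.

Lemma deriv_vf_coord X p (v : TS3 p) j : smooth_vf X ->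
  Defs.deriv (fun q => vsval (X q)) v 0 j =
  Defs.deriv (fun q => vsval (X q) 0 j : R^o) v.
Proof.
move=> sX; pose u : quat R := \row_k Defs.deriv (fun q => vsval (X q) 0 k : R^o) v.
have dX : is_derive (p : quat R) (vsval v) ((fun q => vsval (X q)) \o @retr R) u.
  by apply: is_derive_row => k; rewrite mxE; exact: deriv_compat (sX k).
by rewrite /Defs.deriv; case: dX => _ ->; rewrite mxE.
Qed.

Lemma deriv_frame_coord a p (v : TS3 p) j :
  Defs.deriv (fun q => vsval (frame a q) 0 j : R^o) v =
  qmul (vsval v) (unit_im R a) 0 j.
Proof.
by rewrite -(deriv_vf_coord _ _ (smooth_frame a)) deriv_qmulr.
Qed.

(** The first term is A applied to the derivative of X; the second comes from
    the variation of the frame along v. *)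
Lemma deriv_one_form X p (v : TS3 p) : smooth_vf X ->
  Defs.deriv (fun q => A q (X q) : R^o) v =
  \sum_a (dot (Defs.deriv (fun q => vsval (X q)) v) (vsval (frame a p)) +
          dot (vsval (X p)) (qmul (vsval v) (unit_im R a))) * m a.
Proof.
move=> sX.
have -> : (fun q => A q (X q) : R^o) = fun q => \sum_a fcoord a (X q) * m a.
  by apply/funext => q; exact: AE.
have sc a := smooth_fcoord a sX.
rewrite (derivS3_sum (f := fun a q => fcoord a (X q) * m a)); last first.
  by move=> a; exact: (smoothM (sc a) (smooth_cst _)).
apply: eq_bigr => a _.
rewrite (derivS3M _ (sc a) (smooth_cst _)) derivS3_cst mulr0 add0r mulrC.
congr (_ * _).
rewrite (derivS3_sum (f := fun j q => vsval (X q) 0 j * vsval (frame a q) 0 j));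
  last by move=> j; exact: (smoothM (sX j) (smooth_frame a j)).
rewrite -big_split; apply: eq_bigr => j _.
rewrite (derivS3M _ (sX j) (smooth_frame a j)) deriv_frame_coord.
by rewrite (deriv_vf_coord _ _ sX) /= [RHS]addrC; congr (_ + _); rewrite [LHS]mulrC.
Qed.

(** At p = 1, u e_a is the cross product of the imaginary quaternions u and e_a up
    to a real number, and the triple product is the volume form. At p, the
    identity holds up to multiples of <p, u> and <p, v>, which vanish. *)
Lemma dot_qmul_vol a p (u v : TS3 p) :
  dot (vsval v) (qmul (vsval u) (unit_im R a)) = - vol (frame a p) u v.
Proof.
have [b [c abc]] := cyclic_ex a; rewrite (vol_frame _ _ abc).
have hu : dot p (vsval u) = 0 by have := subvsP u; rewrite tangentE => /eqP.
have hv : dot p (vsval v) = 0 by have := subvsP v; rewrite tangentE => /eqP.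
have : dot p p * dot (vsval v) (qmul (vsval u) (unit_im R a)) =
    dot p (vsval u) * fcoord a v - dot p (vsval v) * fcoord a u
    - (fcoord b u * fcoord c v - fcoord c u * fcoord b v).
  rewrite /fcoord /=; move: abc (vsval u) (vsval v) => + x y.
  rewrite /cyclic !inE => /or3P[] /eqP[-> -> ->];
    by rewrite !qmul_unit !dotE !mkquatE; ring.
by rewrite hu hv (eqP (S3valP p)) mul1r !mul0r subrr sub0r.
Qed.

(** The derivatives of X and Y cancel against those in the bracket; the variation
    of the frame is left, antisymmetrised in X and Y. *)
Lemma left_invariant_solution X Y p : smooth_vf X -> smooth_vf Y ->
  ext_deriv A X Y p + 2 * hodge A X Y p = 0.
Proof.
move=> sX sY; rewrite /ext_deriv !deriv_one_form// AE /hodge.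
rewrite mulr_sumr -!sumrB -big_split big1// => a _ /=.
rewrite /fcoord bracketE// Am.
have -> (x y z : quat R) : dot (x - y) z = dot x z - dot y z.
  by rewrite /dot -sumrB; apply: eq_bigr => j _; rewrite !mxE mulrBl.
have := dot_qmul_unit (vsval (Y p)) (vsval (X p)) a.
rewrite qmulNr dotNr dot_qmul_vol => E.
have -> : dot (vsval (X p)) (qmul (vsval (Y p)) (unit_im R a)) =
    dot (qmul (vsval (Y p)) (unit_im R a)) (vsval (X p)).
  by apply: eq_bigr => j _; exact: mulrC.
by rewrite E; ring.
Qed.

End LeftInvariant.
End OneForms.

Theorem corollary4p3 (R : realType) :
  [set A : one_form R | smooth_form A /\
    forall X Y : vector_field R, smooth_vf X -> smooth_vf Y ->
      forall p : S3 R, ext_deriv A X Y p + 2 * hodge A X Y p = 0]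
  = [set A : one_form R | left_invariant A].
Proof.
apply/seteqP; split=> A /=.
  by move=> [sA dA]; exact: solution_left_invariant.
move=> /left_invariantP[m Am]; split; first exact: left_invariant_smooth Am.
by move=> X Y sX sY p; exact: left_invariant_solution Am _ _ _ sX sY.
Qed.
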